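(* Let $X$ and $Y$ be one-sided shift spaces and let $h\colon X\to Y$ be a homeomorphism. The following are equivalent: (i) the map $h\colon X\to Y$ is a one-sided conjugacy; (ii) there is a conjugacy $\tilde h\colon\widetilde X\to\widetilde Y$ satisfying $h\circ\pi_X=\pi_Y\circ\tilde h$; (iii) there is a groupoid isomorphism $\Psi\colon\mathcal G_X\to\mathcal G_Y$ satisfying $h\circ\pi_X=\pi_Y\circ\Psi^{(0)}$, $c_X=c_Y\circ\Psi$ and $\Psi\circ\epsilon_X=\epsilon_Y\circ\Psi$; (iv) there is a groupoid isomorphism $\Psi\colon\mathcal G_X\to\mathcal G_Y$ satisfying $h\circ\pi_X=\pi_Y\circ\Psi^{(0)}$ and $\Psi\circ\epsilon_X=\epsilon_Y\circ\Psi$; (v) there is a $^*$-isomorphism $\Phi\colon\mathcal O_X\to\mathcal O_Y$ satisfying $\Phi(C(X))=C(Y)$ with $\Phi(g)=g\circ h^{-1}$ for $g\in C(X)$, $\Phi\circ p_X=p_Y\circ\Phi$, $\Phi\circ\gamma^X_z=\gamma^Y_z\circ\Phi$ for $z\in\mathbb T$, $\Phi\circ\phi_X|_{\mathcal D_X}=\phi_Y\circ\Phi|_{\mathcal D_X}$, and $\Phi\circ\tau_X=\tau_Y\circ\Phi$; (vi) there is a $^*$-isomorphism $\Phi\colon\mathcal O_X\to\mathcal O_Y$ satisfying $\Phi(C(X))=C(Y)$ with $\Phi(g)=g\circ h^{-1}$ for $g\in C(X)$, and $\Phi\circ\tau_X=\tau_Y\circ\Phi$; (vii) there is a $^*$-isomorphism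 $\Omega\colon\mathcal D_X\to\mathcal D_Y$ satisfying $\Omega(C(X))=C(Y)$, $\Omega(g)=g\circ h^{-1}$ for $g\in C(X)$ and $\Omega\circ\phi_X|_{\mathcal D_X}=\phi_Y\circ\Omega$.
   Context: **Shift spaces.** $\mathbb N=\{0,1,2,\dots\}$. A one-sided shift space is a closed subset $X\subseteq\mathfrak A^{\mathbb N}$ ($\mathfrak A$ a finite discrete alphabet, product topology) with $\sigma(X)\subseteq X$ (equality not assumed), where $\sigma(x)_n=x_{n+1}$; put $\sigma_X=\sigma|_X$. Write $x_{[i,j)}=x_i\cdots x_{j-1}$, and let $P_l(x)$ be the set of words $\mu$ of length $l$ over $\mathfrak A$ with $\mu x\in X$. A homeomorphism $h\colon X\to Y$ is a (one-sided) conjugacy if $h\circ\sigma_X=\sigma_Y\circ h$; likewise a conjugacy $\tilde h\colon\widetilde X\to\widetilde Y$ is a homeomorphism with $\tilde h\circ\sigma_{\widetilde X}=\sigma_{\widetilde Y}\circ\tilde h$. **Cover.** Let $\mathcal I=\{(k,l)\in\mathbb N\times\mathbb N: k\le l\}$ with $(k_1,l_1)\preceq(k_2,l_2)$ iff $k_1\le k_2$ and $l_1-k_1\le l_2-k_2$. For $(k,l)\in\mathcal I$ let $x\overset{k,l}{\sim}x'$ iff $x_{[0,k)}=x'_{[0,k)}$ and $\bigcup_{l'\le l}P_{l'}(\sigma_X^k(x))=\bigcup_{l'\le l}P_{l'}(\sigma_X^k(x'))$; let ${}_k[x]_l$ be the class of $x$ and ${}_kX_l$ the (finite, discrete) set of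 classes. If $(k_1,l_1)\preceq(k_2,l_2)$ then ${}_{k_2}[x]_{l_2}\mapsto{}_{k_1}[x]_{l_1}$ is well defined, and the cover $\widetilde X$ is the projective limit of the ${}_kX_l$ along these maps, a compact Hausdorff space. The map $\sigma_{\widetilde X}\colon\widetilde X\to\widetilde X$ is defined by: the $(k,l)$-coordinate of $\sigma_{\widetilde X}(\tilde x)$ is ${}_k[\sigma_X(y)]_l$ for any representative $y$ of the $(k+1,l+1)$-coordinate of $\tilde x$ (for $k<l$ one may use the $(k+1,l)$-coordinate); it is a local homeomorphism. The factor map $\pi_X\colon\widetilde X\to X$ sends $\tilde x$ to the unique $x\in X$ such that $x_{[0,k)}=y_{[0,k)}$ for every $(k,l)\in\mathcal I$ and every representative $y$ of the $(k,l)$-coordinate of $\tilde x$; it is a continuous surjection and $\sigma_X\circ\pi_X=\pi_X\circ\sigma_{\widetilde X}$. **Groupoid.** $\mathcal G_X=\{(\tilde x,p,\tilde y)\in\widetilde X\times\mathbb Z\times\widetilde X:\exists i,j\in\mathbb N,\ p=i-j,\ \sigma_{\widetilde X}^i(\tilde x)=\sigma_{\widetilde X}^j(\tilde y)\}$ with product $(\tilde x,p,\tilde y)(\tilde y,q,\tilde z)=(\tilde x,p+q,\tilde z)$ and inverse $(\tilde y,-p,\tilde x)$, and topology generated by the sets $\{(\tilde x,i-j,\tilde y):\tilde x\in U,\tilde y\in V,\sigma_{\widetilde X}^i(\tilde x)=\sigma_{\widetilde X}^j(\tilde y)\}$ with $U,V\subseteq\widetilde X$ open, $\sigma^i_{\widetilde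 X}|_U$, $\sigma^j_{\widetilde X}|_V$ injective and $\sigma_{\widetilde X}^i(U)=\sigma_{\widetilde X}^j(V)$. It is a second-countable locally compact Hausdorff étale amenable groupoid with unit space identified with $\widetilde X$. Groupoid isomorphisms are required to be homeomorphisms, and $\Psi^{(0)}\colon\widetilde X\to\widetilde Y$ is the restriction of $\Psi$ to unit spaces. $c_X\colon\mathcal G_X\to\mathbb Z$ is $c_X(\tilde x,p,\tilde y)=p$, and $\epsilon_X\colon\mathcal G_X\to\mathcal G_X$ is $\epsilon_X(\tilde x,p,\tilde y)=(\sigma_{\widetilde X}(\tilde x),p,\sigma_{\widetilde X}(\tilde y))$. **$C^*$-algebras.** $\mathcal O_X=C^*(\mathcal G_X)$ (full = reduced; elements are regarded as $C_0$-functions on $\mathcal G_X$), $\mathcal D_X=C(\widetilde X)\subseteq\mathcal O_X$ (functions on the unit space), and $C(X)$ is regarded as a subalgebra of $\mathcal D_X$ via $f\mapsto f\circ\pi_X$. $p_X\colon\mathcal O_X\to\mathcal D_X$ is the conditional expectation $p_X(g)(\tilde x)=g(\tilde x,0,\tilde x)$. The gauge action $\gamma^X\colon\mathbb T\curvearrowright\mathcal O_X$ is determined by $\gamma^X_z(g)(\tilde x,p,\tilde y)=z^pg(\tilde x,p,\tilde y)$ for $g\in C_c(\mathcal G_X)$. For $a\in\mathfrak A$ let $s_a\in\mathcal O_X$ be the indicator function of the compact open set $\{(\tilde x,1,\sigma_{\widetilde X}(\tilde x)):\pi_X(\tilde x)_0=a\}$ (the canonical generators of $\mathcal O_X$). Define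 $\phi_X,\tau_X\colon\mathcal O_X\to\mathcal O_X$ by $\phi_X(y)=\sum_{a\in\mathfrak A}s_ays_a^*$ and $\tau_X(y)=\sum_{a,b\in\mathfrak A}s_bys_a^*$. *)

(* Defs.v *)
From HB Require Import structures.
From mathcomp Require Import all_boot all_order all_algebra generic_quotient.
From mathcomp Require Import complex zify.
From mathcomp Require Import all_classical all_reals all_analysis.

Set Implicit Arguments.
Unset Strict Implicit.
Unset Printing Implicit Defensive.

Import Order.TTheory GRing.Theory Num.Theory.
Import numFieldNormedType.Exports.

Local Open Scope classical_set_scope.
Local Open Scope ring_scope.
Local Open Scope quotient_scope.

Record homeo (T U : topologicalType) := Homeo {
  homeo_fun :> T -> U;
  homeo_inv : U -> T;
  homeoK : cancel homeo_fun homeo_inv;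
  homeo_invK : cancel homeo_inv homeo_fun;
  homeo_continuous : continuous homeo_fun;
  homeo_inv_continuous : continuous homeo_inv }.

Definition is_conjugacy (T U : topologicalType) (s : T -> T) (s' : U -> U)
    (h : homeo T U) : Prop :=
  forall x, h (s x) = s' (h x).

Definition full_shift (A : finType) : topologicalType :=
  prod_topology (fun _ : nat => discrete_topology A).

Definition shift_map (A : finType) (x : full_shift A) : full_shift A :=
  fun n => x n.+1.

Record shift_space (A : finType) := ShiftSpace {
  shift_set :> set (full_shift A);
  shift_set_closed : closed shift_set;
  shift_set_sub : @shift_map A @` shift_set `<=` shift_set }.

Notation points X := (set_type (shift_set X)).

Section Shift.
Variables (A : finType) (X : shift_space A).
Implicit Types x y : points X.

Lemma sigma_subproof x : shift_map (val x) \in shift_set X.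
Proof.
by apply/mem_set; apply: shift_set_sub; exists (val x) => //; exact/set_mem/valP.
Qed.

Definition sigma x : points X := exist _ (shift_map (val x)) (sigma_subproof x).

(* The concatenation [mu x]: [nth] returns its default value when
   [size mu <= n]. *)
Definition prepend (mu : seq A) (x : full_shift A) : full_shift A :=
  fun n => nth (x (n - size mu)%N) mu n.

Definition pasts (l : nat) x : set (seq A) :=
  [set mu | size mu = l /\ shift_set X (prepend mu (val x))].

Definition initial_word (k : nat) x : seq A := mkseq (val x) k.

Lemma initial_wordP k x y :
  initial_word k x = initial_word k y <->
  (forall n, (n < k)%N -> val x n = val y n).
Proof.
split=> [e n nk|e].
  by move/(congr1 (fun s => nth (val x n) s n)): e; rewrite !nth_mkseq.
by apply/eq_in_map => n; rewrite mem_iota => /andP[_ nk]; exact: e.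
Qed.

Lemma val_iter_sigma k x n : val (iter k sigma x) n = val x (k + n)%N.
Proof. by elim: k n => // k IH n; rewrite addSnnS -IH. Qed.

Lemma prepend_cat mu nu (x : full_shift A) :
  prepend (mu ++ nu) x = prepend mu (prepend nu x).
Proof.
apply/funext => n; rewrite /prepend nth_cat size_cat subnDA.
by case: ltnP => // h; [apply: set_nth_default|rewrite [RHS]nth_default].
Qed.

Lemma prepend_iter d x :
  prepend (initial_word d x) (val (iter d sigma x)) = val x.
Proof.
apply/funext => n; rewrite /prepend size_mkseq; case: (ltnP n d) => h.
  by rewrite nth_mkseq.
by rewrite nth_default ?size_mkseq// val_iter_sigma subnKC.
Qed.

Definition sim (k l : nat) x y : Prop :=
  initial_word k x = initial_word k y /\
  \bigcup_(m in [set m | (m <= l)%N]) pasts m (iter k sigma x) =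
  \bigcup_(m in [set m | (m <= l)%N]) pasts m (iter k sigma y).

Lemma sim_sym k l x y : sim k l x y -> sim k l y x.
Proof. by case=> /esym ? /esym ?; split. Qed.

Definition simb (k l : nat) : rel (points X) := fun x y => `[< sim k l x y >].

Lemma simb_refl k l : reflexive (simb k l).
Proof. by move=> x; apply/asboolP. Qed.

Lemma simb_sym k l : symmetric (simb k l).
Proof. by move=> x y; apply/asboolP/asboolP; exact: sim_sym. Qed.

Lemma simb_trans k l : transitive (simb k l).
Proof.
by move=> y x z /asboolP[p q] /asboolP[p' q']; apply/asboolP; split;
  [rewrite p|rewrite q].
Qed.

Canonical sim_equiv k l :=
  EquivRel (simb k l) (@simb_refl k l) (@simb_sym k l) (@simb_trans k l).

Definition cover_index := {kl : nat * nat | (kl.1 <= kl.2)%N}.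

Definition index_le (i j : cover_index) : Prop :=
  ((val i).1 <= (val j).1)%N /\
  ((val i).2 - (val i).1 <= (val j).2 - (val j).1)%N.

Definition index_succ (i : cover_index) : cover_index :=
  exist _ ((val i).1.+1, (val i).2.+1) (valP i).

Definition index_diag (k : nat) : cover_index := exist _ (k, k) (leqnn k).

Definition classes (i : cover_index) := {eq_quot sim_equiv (val i).1 (val i).2}.

Definition class_of (i : cover_index) x : classes i := \pi x.

Definition is_repr (i : cover_index) x (c : classes i) : Prop := class_of i x = c.

Lemma class_ofP i x y :
  class_of i x = class_of i y <-> sim (val i).1 (val i).2 x y.
Proof.
split=> [/eqmodP|h]; first by move/asboolP.
by apply/eqmodP/asboolP.
Qed.

Lemma is_repr_repr i (c : classes i) : is_repr (repr c) c.
Proof. exact: reprK. Qed.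

(* The bonding map [k2[x]l2 |-> k1[x]l1]; it is meaningful for
   [index_le i j], see [bondE]. *)
Definition bond (i j : cover_index) (c : classes j) : classes i :=
  class_of i (repr c).

Lemma sim_le i j x y : index_le i j ->
  sim (val j).1 (val j).2 x y -> sim (val i).1 (val i).2 x y.
Proof.
case: i j => -[k1 l1] /= kl1 [[k2 l2] /= kl2] [/= k12 l12].
suff H : forall z z', sim k2 l2 z z' ->
    \bigcup_(m in [set m | (m <= l1)%N]) pasts m (iter k1 sigma z) `<=`
    \bigcup_(m in [set m | (m <= l1)%N]) pasts m (iter k1 sigma z').
  move=> s; split; last by apply/seteqP; split; apply: H => //; exact: sim_sym.
  case: s => /initial_wordP e _; apply/initial_wordP => n nk.
  by apply: e; exact: leq_trans nk k12.
move=> {}x {}y [/initial_wordP e E] mu [m /= ml [smu Xmu]].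
have iterE z : iter (k2 - k1) sigma (iter k1 sigma z) = iter k2 sigma z.
  by rewrite -iterD subnK.
pose w := initial_word (k2 - k1) (iter k1 sigma x).
have wE : w = initial_word (k2 - k1) (iter k1 sigma y).
  by apply/initial_wordP => n nk; rewrite !val_iter_sigma e//; lia.
have : (\bigcup_(m in [set m | (m <= l2)%N]) pasts m (iter k2 sigma x))
    (mu ++ w).
  exists (size (mu ++ w)) => /=.
    by rewrite size_cat size_mkseq smu; lia.
  by split=> //; rewrite prepend_cat -(iterE x) prepend_iter.
rewrite E => -[m' _ [_ X']]; exists m => //; split=> //.
by move: X'; rewrite prepend_cat -(iterE y) wE prepend_iter.
Qed.

Lemma bondE i j x : index_le i j -> bond i (class_of j x) = class_of i x.
Proof.
move=> ij; apply/class_ofP/(sim_le ij)/class_ofP; exact: is_repr_repr.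
Qed.

Lemma sim_sigma k l x y : sim k.+1 l.+1 x y -> sim k l (sigma x) (sigma y).
Proof.
move=> [/initial_wordP e E]; split; first by apply/initial_wordP => n nk; exact: e.
have half z : \bigcup_(m in [set m | (m <= l)%N]) pasts m (iter k.+1 sigma z) =
    (\bigcup_(m in [set m | (m <= l.+1)%N]) pasts m (iter k.+1 sigma z)) `&`
    [set mu | (size mu <= l)%N].
  apply/seteqP; split=> mu.
    by case=> m /= ml [smu Xmu]; split; [exists m => //=; exact: leqW|rewrite /= smu].
  by case=> -[m _ [smu Xmu]] /= ml; exists m => //=; rewrite -smu.
by rewrite -!iterSr !half E.
Qed.

Definition cover_set :
    set (prod_topology (fun i : cover_index => discrete_topology (classes i))) :=
  [set t | forall i j, index_le i j -> bond i (t j) = t i].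

Definition cover_space : topologicalType := set_type cover_set.

Implicit Types t : cover_space.

Definition coord t (i : cover_index) : classes i := val t i.

Lemma coord_bond t i j : index_le i j -> bond i (coord t j) = coord t i.
Proof. by move=> ij; have /set_mem := valP t; exact. Qed.

Lemma sigma_cover_subproof t :
  ((fun i => class_of i (sigma (repr (coord t (index_succ i))))) :
    prod_topology (fun i => discrete_topology (classes i))) \in cover_set.
Proof.
apply/mem_set => i j ij /=; rewrite bondE//; apply/class_ofP/sim_sigma.
apply/(class_ofP (index_succ i)).
have ij' : index_le (index_succ i) (index_succ j) by case: ij.
by rewrite [RHS]is_repr_repr; exact: (coord_bond t ij').
Qed.

Definition sigma_cover t : cover_space :=
  exist _ (fun i => class_of i (sigma (repr (coord t (index_succ i)))))
    (sigma_cover_subproof t).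

Lemma coord_sigma_cover t i y : is_repr y (coord t (index_succ i)) ->
  coord (sigma_cover t) i = class_of i (sigma y).
Proof.
move=> yt; apply/class_ofP/sim_sigma/(class_ofP (index_succ i)).
by rewrite yt; exact: is_repr_repr.
Qed.

Definition pi_cover_fun t : full_shift A :=
  fun n => val (repr (coord t (index_diag n.+1))) n.

Lemma pi_cover_funP t i y : is_repr y (coord t i) ->
  initial_word (val i).1 y = mkseq (pi_cover_fun t) (val i).1.
Proof.
move=> yt; apply/eq_in_map => n; rewrite mem_iota => /andP[_ nk] /=.
have ij : index_le (index_diag n.+1) i by split; [exact: nk|rewrite /= subnn].
have /class_ofP[/initial_wordP + _] : class_of (index_diag n.+1) y =
    class_of (index_diag n.+1) (repr (coord t (index_diag n.+1))).
  by rewrite [RHS]is_repr_repr -(coord_bond t ij) -yt bondE.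
by apply => /=.
Qed.

Lemma pi_cover_subproof t : pi_cover_fun t \in shift_set X.
Proof.
apply/mem_set.
pose u (k : nat) : full_shift A := val (repr (coord t (index_diag k))).
have : u @ \oo --> pi_cover_fun t.
  apply/cvg_sup => n U [V [[W oW <-] Wn] WU].
  suff : \forall k \near \oo, U (u k) by [].
  near=> k; apply: WU => /=.
  have nk : (n < k)%N by near: k; exact: nbhs_infty_gt.
  have := pi_cover_funP (is_repr_repr (coord t (index_diag k))).
  move/(congr1 (fun s => nth (u k n) s n)); rewrite !nth_mkseq// => e.
  by rewrite /u e.
apply: (closed_cvg (shift_set X)); first exact: shift_set_closed.
by near=> k; exact/set_mem/valP.
Unshelve. all: by end_near.
Qed.

Definition pi_cover t : points X := exist _ (pi_cover_fun t) (pi_cover_subproof t).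

Lemma pi_coverP t i y : is_repr y (coord t i) ->
  initial_word (val i).1 (pi_cover t) = initial_word (val i).1 y.
Proof. by move=> yt; rewrite (pi_cover_funP yt). Qed.

Definition groupoid_set : set (cover_space * int * cover_space) :=
  [set g | exists i j : nat, g.1.2 = i%:Z - j%:Z /\
                             iter i sigma_cover g.1.1 = iter j sigma_cover g.2].

(* A wrapper around [groupoid_set]: the topology of the groupoid is not the
   one induced by the product topology. *)
Record groupoid := Arrow {
  arrow_val : cover_space * int * cover_space;
  arrowP : arrow_val \in groupoid_set }.

HB.instance Definition _ := [isSub for arrow_val].
HB.instance Definition _ := [Choice of groupoid by <:].

Implicit Types g : groupoid.

Definition rng g : cover_space := (val g).1.1.
Definition cocycle g : int := (val g).1.2.
Definition src g : cover_space := (val g).2.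

Definition groupoid_subbase : set (set groupoid) :=
  [set Z | exists (U V : set cover_space) (i j : nat),
    [/\ open U, open V, set_inj U (iter i sigma_cover),
        set_inj V (iter j sigma_cover) &
        iter i sigma_cover @` U = iter j sigma_cover @` V] /\
    Z = [set g | [/\ U (rng g), V (src g), cocycle g = i%:Z - j%:Z &
                    iter i sigma_cover (rng g) = iter j sigma_cover (src g)]]].

HB.instance Definition _ :=
  isSubBaseTopological.Build groupoid groupoid_subbase id.

Lemma gunit_subproof t : (t, 0, t) \in groupoid_set.
Proof. by apply/mem_set; exists 0%N, 0%N. Qed.

Definition gunit t : groupoid := Arrow (gunit_subproof t).

Lemma ginv_subproof g : (src g, - cocycle g, rng g) \in groupoid_set.
Proof.
have /set_mem[i [j [e s]]] := arrowP g; apply/mem_set; exists j, i.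
by split => /=; [rewrite /cocycle e opprB|rewrite /src /rng s].
Qed.

Definition ginv g : groupoid := Arrow (ginv_subproof g).

Definition composable g g' : Prop := src g = rng g'.

Lemma gmul_subproof g g' : composable g g' ->
  (rng g, cocycle g + cocycle g', src g') \in groupoid_set.
Proof.
have /set_mem[i [j [e s]]] := arrowP g; have /set_mem[k [l [e' s']]] := arrowP g'.
move=> gg'; apply/mem_set; exists (k + i)%N, (j + l)%N; split => /=.
  by rewrite /cocycle e e'; lia.
by rewrite !iterD s -s' -!iterD addnC; congr iter.
Qed.

Definition gmul g g' (gg' : composable g g') : groupoid := Arrow (gmul_subproof gg').

Lemma eps_subproof g :
  (sigma_cover (rng g), cocycle g, sigma_cover (src g)) \in groupoid_set.
Proof.
have /set_mem[i [j [e s]]] := arrowP g; apply/mem_set; exists i, j; split=> //=.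
by rewrite -!iterSr !iterS s.
Qed.

Definition eps g : groupoid := Arrow (eps_subproof g).

End Shift.

(* The sum of an absolutely summable family, indexed by an arbitrary set; the
   value is meaningless for other families. *)
Definition rsum (R : realType) (T : choiceType) (D : set T) (f : T -> R) : R :=
  fine (\esum_(t in D) ((f^\+ t)%:E)) - fine (\esum_(t in D) ((f^\- t)%:E)).

Definition csum (R : realType) (T : choiceType) (D : set T) (f : T -> R[i]) :
    R[i] :=
  Complex (rsum D (fun t => complex.Re (f t))) (rsum D (fun t => complex.Im (f t))).

Section Algebra.
Variables (R : realType) (A : finType) (X : shift_space A).
Local Notation G := (groupoid X).
Implicit Types f g xi : G -> R[i].

Definition factorizations (c : G) : set (G * G) :=
  [set ab | exists h : composable ab.1 ab.2, gmul h = c].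

Definition convolution f g : G -> R[i] :=
  fun c => csum (factorizations c) (fun ab => f ab.1 * g ab.2).

Definition star f : G -> R[i] := fun c => (f (ginv c))^*.

Definition Cc : set (G -> R[i]) :=
  [set f | continuous (f : G -> R[i]^o) /\ compact (closure [set c | f c != 0])].

Definition l2norm xi : \bar R :=
  sqrte (\esum_(c in [set: G]) (complex.Re `|xi c| ^+ 2)%:E).

(* The dense subspace of finitely supported vectors of
   l^2(G_t), G_t = {c | src c = t}. *)
Definition finite_vectors (t : cover_space X) : set (G -> R[i]) :=
  [set xi | finite_set [set c | xi c != 0] /\
            [set c | xi c != 0] `<=` [set c | src c = t]].

(* The supremum over the units [t] of the operator norms of the regular
   representations [xi |-> convolution f xi] on l^2(G_t); for fixed [c] the sum
   defining [convolution f xi c] has finitely many nonzero terms, so this makes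
   sense for every function [f], with value [+oo] allowed. *)
Definition reduced_norm f : \bar R :=
  ereal_sup [set l2norm (convolution f xi) |
    xi in [set xi | (exists t, finite_vectors t xi) /\ (l2norm xi <= 1)%E]].

(* The full and the reduced C*-algebra of G coincide. The reduced one embeds into
   the functions on G by evaluating the regular representations at the point
   masses of units. Since [reduced_norm] dominates the supremum norm, the image
   of this embedding is the closure of [Cc] for [reduced_norm], and products and
   adjoints of elements are given by [convolution] (an absolutely convergent sum,
   by Cauchy-Schwarz) and [star]. *)
Definition OX : set (G -> R[i]) :=
  [set g | forall e : R, 0 < e ->
    exists f, Cc f /\ (reduced_norm (g \- f)%R <= e%:E)%E].

Definition on_units (d : cover_space X -> R[i]) : G -> R[i] :=
  fun c => if `[< c = gunit (rng c) >] then d (rng c) else 0.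

Definition DX : set (G -> R[i]) :=
  [set on_units d | d in [set d | continuous (d : cover_space X -> R[i]^o)]].

Definition of_CX (f : points X -> R[i]) : G -> R[i] := on_units (f \o @pi_cover A X).

Definition CX : set (G -> R[i]) :=
  [set of_CX f | f in [set f | continuous (f : points X -> R[i]^o)]].

Definition cond_exp g : G -> R[i] := on_units (fun t => g (gunit t)).

(* The formula defining the gauge action on [Cc] holds on all of [OX]. *)
Definition gauge (z : R[i]) g : G -> R[i] := fun c => z ^ cocycle c * g c.

Definition gen (a : A) : G -> R[i] :=
  \1_[set c : G | [/\ cocycle c = 1, src c = sigma_cover (rng c) &
                   val (pi_cover (rng c)) 0%N = a]].

Definition phi (y : G -> R[i]) : G -> R[i] :=
  \sum_(a : A) convolution (convolution (gen a) y) (star (gen a)).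

Definition tau (y : G -> R[i]) : G -> R[i] :=
  \sum_(a : A) \sum_(b : A) convolution (convolution (gen b) y) (star (gen a)).

End Algebra.

Section Isomorphisms.
Variables (R : realType) (A B : finType) (X : shift_space A) (Y : shift_space B).

Definition unit_map (Psi : groupoid X -> groupoid Y) (t : cover_space X) :
  cover_space Y := rng (Psi (gunit t)).

Definition is_groupoid_iso (Psi : homeo (groupoid X) (groupoid Y)) : Prop :=
  forall (c c' : groupoid X) (h : composable c c'),
    exists h' : composable (Psi c) (Psi c'), Psi (gmul h) = gmul h'.

(* [Phi] restricts to a star-isomorphism between the star-algebras [S] and [S']
   of functions on the groupoids; its values off [S] are irrelevant. *)
Definition is_star_iso (S : set (groupoid X -> R[i])) (S' : set (groupoid Y -> R[i]))
    (Phi : (groupoid X -> R[i]) -> (groupoid Y -> R[i])) : Prop :=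
  [/\ set_bij S S' Phi,
      forall f g, S f -> S g -> Phi (f \+ g) = Phi f \+ Phi g,
      forall k f, S f -> Phi (k \*o f) = k \*o Phi f,
      forall f g, S f -> S g -> Phi (convolution f g) = convolution (Phi f) (Phi g) &
      forall f, S f -> Phi (star f) = star (Phi f)].

Definition extends_homeo (h : homeo (points X) (points Y))
    (Phi : (groupoid X -> R[i]) -> (groupoid Y -> R[i])) : Prop :=
  Phi @` @CX R A X = @CX R B Y /\
  forall f : points X -> R[i], continuous (f : points X -> R[i]^o) ->
    Phi (of_CX f) = of_CX (f \o homeo_inv h).

End Isomorphisms.

(* Main.v *)
Require Import Defs.
From HB Require Import structures.
From mathcomp Require Import all_boot all_order all_algebra.
From mathcomp Require Import complex finmap zify.
From mathcomp Require Import all_classical all_reals all_analysis.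

(** The cover of a shift space is the completion of the space for the uniformity
    whose basic entourages are the relations [sim k l].  Its points are dense in
    it ([embed_dense]), a map of points which is uniformly continuous for these
    relations extends to a continuous map of covers ([lift_cover]), and identities
    between continuous maps of covers need only be checked on embedded points.
    Three facts follow.

    A conjugacy [h] is a sliding block code by compactness, so the past of [x] of
    a given depth and a long enough initial word of [x] determine the past of
    [h x] of that depth ([conjugacy_sim_continuous]).  Hence [h] and its inverse
    lift to the covers, and the lift is a conjugacy over [h] ([cover_conjugacy]).

    Prepending a letter, where this is possible, is also uniformly continuous.
    Its extension to the cover inverts the shift on the points with that first
    letter ([sigma_cover_branch]), so the shift of the cover is a local
    homeomorphism.  This controls the topology of the groupoid; in particular
    [tail_arrows n], the arrows of degree zero between points with the same
    [n]-th iterate, form a compact open set.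

    A conjugacy [th] of covers acts on arrows by [(t, p, t') |-> (th t, p, th t')],
    and pulling functions back along this isomorphism of groupoids preserves all
    that is defined from the groupoid structure.  The canonical generators need
    not be preserved, since the alphabets differ, but [phi] on the diagonal and
    [tau] are: as each sum that defines a product with a generator has a single
    term, [tau y] is [y] composed with [eps] ([tauE]), and [phi] is composition
    with the shift on functions of the cover ([phi_on_units]).

    Conversely each of the other conditions forces [h] to commute with the shifts.
    For groupoids, evaluate at units the fact that [Psi] commutes with [eps].  For
    algebras, let [f] be a continuous function on [X].  Since [phi] maps [f] to
    [f] composed with the shift, a map that commutes with [phi] and sends [f] to
    [f] composed with the inverse of [h] yields the commutation relation, tested
    on [f] ([conjugacy_of_diagonal_iso]).  For [tau] one has the factorization
    [tau f = (f \o sigma) * tau 1] ([tau_of_CX]); here [tau 1] is the indicator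
    function of [tail_arrows 1], hence lies in the algebra, and it takes the
    value 1 at units.  Multiplicativity of the isomorphism and evaluation at
    units then give the same conclusion ([conjugacy_of_tau_iso]). *)

Set Implicit Arguments.
Unset Strict Implicit.
Unset Printing Implicit Defensive.

Import Order.TTheory GRing.Theory Num.Theory.
Import numFieldNormedType.Exports.

Local Open Scope classical_set_scope.
Local Open Scope ring_scope.

Local Notation coord := Defs.coord.

(** * Closed subspaces of products of discrete spaces *)

Lemma comp_continuous (T U V : topologicalType) (f : T -> U) (g : U -> V) :
  continuous f -> continuous g -> continuous (g \o f).
Proof. by move=> cf cg t; apply: continuous_comp; [exact: cf|exact: cg]. Qed.

Section ProDiscrete.
Variables (I : eqType) (D : I -> choiceType).
Let P : topologicalType := prod_topology (fun i => discrete_topology (D i)).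
Variable S : set P.
Implicit Types t : set_type S.

Lemma nbhs_coordinate t i : nbhs t [set t' : set_type S | val t' i = val t i].
Proof.
have c := @proj_continuous I (fun i => discrete_topology (D i)) i (val t).
have : nbhs (val t : P) [set f : P | f i = val t i].
  apply: (c [set d | d = val t i]).
  exact: (@discrete_set1 (discrete_topology (D i))).
exact: (@initial_continuous _ P).
Qed.

(** The coordinates generate the topology.  Stated for a filter on the subspace
    so that it can be applied to the filters of cylinders below, which makes the
    cylinders a neighbourhood basis. *)
Lemma cvg_coordinates (F : set_system (set_type S)) t : Filter F ->
  (forall i, F [set t' : set_type S | val t' i = val t i]) -> F --> t.
Proof.
move=> FF Ft U [V [[W oW <-] Wt] WU].
have cW : (val @ F) --> (val t : P).
  apply/cvg_sup => i B [C [[E oE <-] Et] EB].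
  suff : F [set t' | B (val t')] by [].
  by apply: filterS (Ft i) => t' /= e; apply: EB => /=; rewrite /= e.
have /cW FW : nbhs (val t : P) W by apply: open_nbhs_nbhs; split.
suff : F [set t' | W (val t')] by apply: filterS => t' ?; exact: WU.
exact: FW.
Qed.

Lemma compact_pro_discrete : (forall i, finite_set [set: D i]) -> closed S ->
  compact [set: set_type S].
Proof.
move=> fD cS F FF _.
have cP : compact [set: P].
  have e : [set: P] = [set f | forall i, [set: D i] (f i)] by apply/seteqP.
  rewrite e; exact: (@tychonoff I (fun i => discrete_topology (D i)) (fun=> setT)
    (fun i => @finite_compact (discrete_topology (D i)) setT (fD i))).
have cSP : compact S by exact: subclosed_compact cS cP _.
have FS : (val @ F) S.
  suff : F [set t | S (val t)] by [].
  by apply: filterE => t; exact: set_mem (valP t).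
have [p [Sp clp]] := cSP _ _ FS.
exists (exist _ p (mem_set Sp)); split=> // B C FB [V [[W oW <-] Wp] WC].
have pW : nbhs p W by apply: open_nbhs_nbhs; split.
have FB' : (val @ F) (val @` B).
  suff : F [set t | (val @` B) (val t)] by [].
  by apply: filterS FB => t Bt; exists t.
have [_ [[t Bt <-] Wt]] := clp _ W FB' pW.
by exists t; split=> //; exact: WC.
Qed.

(** Two distinct points are separated by a coordinate, which is locally constant.
    Together with density of the embedded points this is the principle by which
    identities are transferred to the cover. *)
Lemma closed_eq_pro_discrete (T : topologicalType) (f g : T -> set_type S) :
  continuous f -> continuous g -> closed [set x | f x = g x].
Proof.
move=> cf cg x clx; apply: contrapT => nfg.
have [i ni] : exists i, val (f x) i <> val (g x) i.
  apply/existsNP => e; apply/nfg/val_inj.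
  exact: functional_extensionality_dep.
have nx : nbhs x [set y | val (f y) i = val (f x) i /\ val (g y) i = val (g x) i].
  by apply: filterI; [exact: (cf x _ (nbhs_coordinate _ i))|
                      exact: (cg x _ (nbhs_coordinate _ i))].
have [y [/= fg [ef eg]]] := clx _ nx.
by apply: ni; apply: eq_trans (esym ef) _; rewrite fg; exact: eg.
Qed.

End ProDiscrete.

(** * Neighbourhoods in shift spaces and in the cover *)

Section Cover.
Variables (A : finType) (X : shift_space A).
Implicit Types (x y : points X) (t : cover_space X).

Lemma nbhs_initial_word x (U : set (points X)) :
  nbhs x U <-> exists k, forall y, initial_word k y = initial_word k x -> U y.
Proof.
split.
  pose F := filter_from [set: nat]
    (fun k => [set y : points X | initial_word k y = initial_word k x]).
  have FF : Filter F.
    apply: filter_from_filter; first by exists 0%N.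
    move=> i j _ _; exists (maxn i j) => // y /initial_wordP e.
    by split; apply/initial_wordP => n ni; apply: e; rewrite leq_max ni ?orbT.
  have FS : F --> x.
    apply: cvg_coordinates => n; exists n.+1 => // y /initial_wordP; exact.
  by move=> /FS[k _ kU]; exists k => y /kU.
move=> [k kU]; suff : nbhs x [set y : points X | initial_word k y = initial_word k x].
  by apply: filterS => y /kU.
elim: k {kU} => [|k IH]; first exact: filterE.
apply: filterS2 IH (nbhs_coordinate x k) => y /initial_wordP e ek.
by apply/initial_wordP => n; rewrite ltnS leq_eqVlt => /predU1P[->//|]; exact: e.
Qed.

(** The cover is a limit over a directed index set, so a single coordinate
    describes a basic neighbourhood. *)
Lemma cover_index_directed (i j : cover_index) : exists m, index_le i m /\ index_le j m.
Proof.
case: i j => -[k1 l1] /= h1 [[k2 l2] /= h2].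
have h : (maxn k1 k2 <= maxn k1 k2 + maxn (l1 - k1) (l2 - k2))%N by exact: leq_addr.
exists (exist _ (maxn k1 k2, (maxn k1 k2 + maxn (l1 - k1) (l2 - k2))%N) h).
by rewrite /index_le /=; lia.
Qed.

Lemma nbhs_coord t (U : set (cover_space X)) :
  nbhs t U <-> exists i, forall t', coord t' i = coord t i -> U t'.
Proof.
split; last first.
  by move=> [i iU]; apply: filterS (nbhs_coordinate t i) => t' e; exact: iU.
pose F := filter_from [set: cover_index]
  (fun i => [set t' : cover_space X | coord t' i = coord t i]).
have FF : Filter F.
  apply: filter_from_filter; first by exists (index_diag 0).
  move=> i j _ _; have [m [im jm]] := cover_index_directed i j; exists m => // t' /= e.
  by rewrite -!(coord_bond _ im) -!(coord_bond _ jm) e.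
have FS : F --> t by apply: cvg_coordinates => i; exists i.
by move=> /FS[i _ iU]; exists i => t' /iU.
Qed.

Lemma cover_ext t t' : (forall i, coord t i = coord t' i) -> t = t'.
Proof. by move=> e; apply: val_inj; exact: functional_extensionality_dep. Qed.

Lemma embed_subproof x :
  ((fun i => class_of i x) :
    prod_topology (fun i => discrete_topology (classes X i))) \in @cover_set A X.
Proof. by apply/mem_set => i j ij; exact: bondE. Qed.

(** A section of [pi_cover]; it is in general not continuous. *)
Definition embed x : cover_space X := exist _ (fun i => class_of i x) (embed_subproof x).

Lemma pi_embed x : pi_cover (embed x) = x.
Proof.
apply: val_inj; apply/funext => n.
have /initial_wordP := @pi_coverP _ _ (embed x) (index_diag n.+1) x erefl.
exact.
Qed.

(** Any representative of a coordinate of [t] embeds into the basic neighbourhood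
    of [t] given by this coordinate. *)
Lemma embed_dense (Q : set (cover_space X)) :
  closed Q -> (forall x, Q (embed x)) -> forall t, Q t.
Proof.
move=> cQ Qe t; apply: cQ => U /nbhs_coord[i iU].
exists (embed (repr (coord t i))); split=> //.
by apply: iU; exact: is_repr_repr.
Qed.

Lemma pi_cover_continuous : continuous (@pi_cover A X).
Proof.
move=> t U /nbhs_initial_word[k kU]; apply/nbhs_coord; exists (index_diag k) => t' e.
have r := is_repr_repr (coord t (index_diag k)).
apply: kU; apply: etrans (esym (pi_coverP r)).
by apply: (@pi_coverP _ _ _ (index_diag k)); rewrite /is_repr e.
Qed.

End Cover.

Lemma cover_continuous (A : finType) (X : shift_space A) (B : finType) (Y : shift_space B)
    (F : cover_space X -> cover_space Y) :
  (forall i, exists j, forall t t', coord t j = coord t' j ->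
     coord (F t) i = coord (F t') i) -> continuous F.
Proof.
move=> h t U /nbhs_coord[i iU]; apply/nbhs_coord.
by have [j jF] := h i; exists j => t' /jF /iU.
Qed.

Section CoverShift.
Variables (A : finType) (X : shift_space A).
Implicit Types (x y : points X) (t : cover_space X).

Lemma sigma_embed x : sigma_cover (embed x) = embed (sigma x).
Proof. by apply: cover_ext => i; exact: coord_sigma_cover. Qed.

Lemma sigma_cover_continuous : continuous (@sigma_cover A X).
Proof.
apply: cover_continuous => i; exists (index_succ i) => t t' e.
rewrite (coord_sigma_cover (is_repr_repr _)).
by apply/esym/coord_sigma_cover; rewrite -e; exact: is_repr_repr.
Qed.

Lemma pi_sigma t : pi_cover (sigma_cover t) = sigma (pi_cover t).
Proof.
apply: val_inj; apply/funext => n.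
set r := repr (coord t (index_succ (index_diag n.+1))).
have tr : is_repr r (coord t (index_succ (index_diag n.+1))) by exact: is_repr_repr.
have sr : is_repr (sigma r) (coord (sigma_cover t) (index_diag n.+1)).
  by rewrite (coord_sigma_cover tr).
have /initial_wordP e1 := pi_coverP sr; have /initial_wordP e2 := pi_coverP tr.
exact: etrans (e1 n (ltnSn n)) (esym (e2 n.+1 (ltnSn _))).
Qed.

Lemma sim_pastsP k l x y : sim k l x y <->
  initial_word k x = initial_word k y /\
  (forall mu, (size mu <= l)%N -> shift_set X (prepend mu (val (iter k (@sigma A X) x))) <->
     shift_set X (prepend mu (val (iter k (@sigma A X) y)))).
Proof.
have E z : \bigcup_(m in [set m | (m <= l)%N]) pasts m (iter k (@sigma A X) z) =
    [set mu | (size mu <= l)%N /\ shift_set X (prepend mu (val (iter k (@sigma A X) z)))].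
  apply/seteqP; split=> [mu [m /= ml [sm Xmu]]|mu [ml Xmu]].
    by rewrite sm.
  by exists (size mu).
rewrite /sim !E; split=> -[e h]; split=> //.
  move=> mu ml; move/seteqP: h => [h1 h2].
  by split=> Xmu; [case: (h1 mu)|case: (h2 mu)].
by apply/seteqP; split=> mu [/= ml Xmu]; split=> //; apply/(h mu ml).
Qed.

End CoverShift.

(** * Compactness *)

Section Compact.
Variables (A : finType) (X : shift_space A).

Lemma compact_points : compact [set: points X].
Proof.
apply: compact_pro_discrete => [_|]; first exact: finite_finset.
exact: shift_set_closed.
Qed.

(** A class is determined by a word of length [k] and a set of words of length at
    most [l]. *)
Lemma finite_classes i : finite_set [set: classes X i].
Proof.
case: i => -[k l] /= kl; set i : cover_index := exist _ _ _.
pose past x : {set l.-bseq A} :=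
  [set mu : l.-bseq A | `[< shift_set X (prepend mu (val (iter k (@sigma A X) x))) >]]%SET.
pose data (c : classes X i) := ([tuple of mkseq (val (repr c)) k], past (repr c)).
rewrite -[setT]/(data @^-1` setT); apply: finite_preimage; last exact: finite_finset.
move=> c c' _ _ [e1 e2].
rewrite -[c]is_repr_repr -[c']is_repr_repr; apply/class_ofP/sim_pastsP; split=> //.
move=> mu ml; move/setP/(_ (Bseq ml)): e2; rewrite !inE /=.
by move=> e; split=> /asboolP; [rewrite e|rewrite -e] => /asboolP.
Qed.

Lemma compact_cover_space : compact [set: cover_space X].
Proof.
apply: compact_pro_discrete => [i|]; first exact: finite_classes.
move=> p clp i j ij.
pose U := [set f : prod_topology (fun i => discrete_topology (classes X i)) |
  f i = p i /\ f j = p j].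
have nU : nbhs p U.
  have H k : nbhs p [set f : prod_topology (fun i => discrete_topology (classes X i)) |
      f k = p k].
    apply: (@proj_continuous _ (fun i => discrete_topology (classes X i)) k p
      [set d | d = p k]).
    exact: (@discrete_set1 (discrete_topology (classes X k))).
  exact: filterI (H i) (H j).
by have [f [/(_ i j ij) + [fi fj]]] := clp _ nU; rewrite fi fj.
Qed.

End Compact.

(** * Extending maps to the cover *)

Section Lift.
Variables (A B : finType) (X : shift_space A) (Y : shift_space B).

(** Uniform continuity for the uniformity generated by the relations [sim]. *)
Definition sim_continuous (f : points X -> points Y) : Prop :=
  forall i : cover_index, exists j : cover_index, forall x y,
    sim (val j).1 (val j).2 x y -> sim (val i).1 (val i).2 (f x) (f y).

(** The extension of a uniformly continuous map to the completion: the [i]-th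
    coordinate of the image of [t] is the class of [f y] for any [y] close enough
    to [t].  Directedness of the index set makes the coordinates compatible. *)
Lemma lift_cover f : sim_continuous f ->
  exists F : cover_space X -> cover_space Y,
    continuous F /\ forall x, F (embed x) = embed (f x).
Proof.
move=> /choice[phi hphi].
pose G t i := class_of i (f (repr (coord t (phi i)))).
have GE t i y : is_repr y (coord t (phi i)) -> G t i = class_of i (f y).
  move=> ty; apply/class_ofP/hphi/class_ofP; rewrite [RHS]ty.
  exact: is_repr_repr.
have Gsub t : (G t : prod_topology (fun i => discrete_topology (classes Y i)))
    \in @cover_set B Y.
  apply/mem_set => i j ij; have [m [im jm]] := cover_index_directed (phi i) (phi j).
  pose y := repr (coord t m).
  rewrite (GE t i y) ?(GE t j y); last 2 first.
  - exact: coord_bond.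
  - exact: coord_bond.
  exact: bondE.
exists (fun t => exist _ (G t) (Gsub t)); split.
  by apply: cover_continuous => i; exists (phi i) => t t' e; rewrite /Defs.coord /= /G e.
by move=> x; apply: cover_ext => i; exact: GE.
Qed.

End Lift.

Lemma iter_commute (T U : Type) (s : T -> T) (s' : U -> U) (f : T -> U) :
  (forall x, f (s x) = s' (f x)) -> forall n x, f (iter n s x) = iter n s' (f x).
Proof. by move=> fs; elim=> //= n IH x; rewrite fs IH. Qed.

Definition to_point (A : finType) (X : shift_space A) (u : full_shift A)
  (Xu : shift_set X u) : points X := SigSub (mem_set Xu).

Lemma prepend_decomposition (A : finType) (X : shift_space A) mu (x z : points X) :
  val z = prepend mu (val x) ->
  initial_word (size mu) z = mu /\ iter (size mu) (@sigma A X) z = x.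
Proof.
move=> e; split.
  case: mu e => // a mu e; apply: (@eq_from_nth _ a); first by rewrite size_mkseq.
  move=> n; rewrite size_mkseq => nm; rewrite nth_mkseq// e /prepend.
  exact: set_nth_default.
apply: val_inj; apply/funext => n; rewrite val_iter_sigma e /prepend.
by rewrite nth_default ?leq_addr// addKn.
Qed.

Section SlidingBlock.
Variables (A B : finType) (X : shift_space A) (Y : shift_space B).

(** The Curtis-Hedlund-Lyndon theorem.  The first letter of [f x] is a locally
    constant function of [x], hence depends on an initial word of bounded length
    by compactness; commutation with the shifts carries this to all letters. *)
Lemma sliding_block_window (f : points X -> points Y) :
  continuous f -> (forall x, f (sigma x) = sigma (f x)) ->
  exists n, forall x y k k', (forall j, (j < n)%N -> val x (k + j)%N = val y (k' + j)%N) ->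
    val (f x) k = val (f y) k'.
Proof.
move=> cf fs.
have [n nP] : exists n, forall x, [set: points X] x -> forall y,
    initial_word n x = initial_word n y -> val (f x) 0%N = val (f y) 0%N.
  apply: (@filter_ex _ \oo).
  have nc := (compact_near_coveringP _).1 (@compact_points A X).
  apply: (nc nat \oo (fun n x => forall y, initial_word n x = initial_word n y ->
    val (f x) 0%N = val (f y) 0%N)) => x _.
  have /nbhs_initial_word[k kU] := cf x _ (nbhs_coordinate (f x) 0%N).
  exists ([set x' | initial_word k x' = initial_word k x], [set n | (k <= n)%N]).
    split; first by apply/nbhs_initial_word; exists k.
    exact: nbhs_infty_ge.
  move=> [x' n] /= [e kn] y /initial_wordP e'.
  rewrite (kU x' e) (kU y)// -e; apply/initial_wordP => m mk.
  by apply/esym/e'; exact: leq_trans kn.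
exists n => x y k k' e.
have E z m : val (f z) m = val (f (iter m (@sigma A X) z)) 0%N.
  by rewrite (iter_commute fs) val_iter_sigma addn0.
rewrite (E x) (E y); apply: nP => //; apply/initial_wordP => m mn.
by rewrite !val_iter_sigma e.
Qed.

(** If [nu] is a past of [sigma^k (h x)], applying the inverse of [h] to
    [nu sigma^k (h x)] yields a past [mu] of [sigma^k x] of the same length.  When
    [y] is close to [x], [mu] is a past of [sigma^k y] as well, and the image under
    [h] of [mu sigma^k y] begins with [nu]: its first letters only depend on [mu]
    and on the letters of [y] in a window which [x] and [y] share. *)
Lemma conjugacy_sim_continuous (h : homeo (points X) (points Y)) :
  is_conjugacy (@sigma A X) (@sigma B Y) h -> sim_continuous h.
Proof.
move=> hs; have [n nP] := sliding_block_window (@homeo_continuous _ _ h) hs.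
move=> [[k l] /= kl].
have kl' : (k + n <= l + n)%N by rewrite leq_add2r.
(* Both entries grow by the window length: a past of [sigma^k x] of length at most
   [l], followed by a window of [n] letters, is a past of [sigma^(k + n) x]. *)
exists (exist _ (k + n, l + n)%N kl') => /=.
suff pasts x y : sim (k + n) (l + n) x y -> forall nu, (size nu <= l)%N ->
    shift_set Y (prepend nu (val (iter k (@sigma B Y) (h x)))) ->
    shift_set Y (prepend nu (val (iter k (@sigma B Y) (h y)))).
  move=> x y s; apply/sim_pastsP; split; last first.
    by move=> nu nul; split; apply: pasts => //; exact: sim_sym.
  case: s => /initial_wordP e _; apply/initial_wordP => m mk.
  by apply: nP => j jn; apply: e; lia.
move=> s nu nul Ynu.
have [/initial_wordP exy _] := s.
have /sim_pastsP[_ skl] : sim k l x y.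
  apply: (@sim_le _ _ (exist _ (k, l) kl) (exist _ (k + n, l + n)%N kl')) s.
  by rewrite /index_le /=; lia.
pose y0 := to_point Ynu.
have [w0 t0] := @prepend_decomposition _ _ nu (iter k (@sigma B Y) (h x)) y0 erefl.
pose z := homeo_inv h y0; have hz : h z = y0 by exact: homeo_invK.
have tz : iter (size nu) (@sigma A X) z = iter k (@sigma A X) x.
  by apply: (can_inj (@homeoK _ _ h)); rewrite !(iter_commute hs) hz t0.
pose mu := initial_word (size nu) z.
have smu : size mu = size nu by exact: size_mkseq.
have Xx : shift_set X (prepend mu (val (iter k (@sigma A X) x))).
  by rewrite -tz prepend_iter; exact: set_mem (valP z).
have Xy : shift_set X (prepend mu (val (iter k (@sigma A X) y))).
  by apply/skl; rewrite ?smu.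
pose z' := to_point Xy.
have [wz' tz'] := @prepend_decomposition _ _ mu (iter k (@sigma A X) y) z' erefl.
suff -> : prepend nu (val (iter k (@sigma B Y) (h y))) = val (h z').
  exact: set_mem (valP (h z')).
rewrite -(prepend_iter (size mu) (h z')) -(iter_commute hs (size mu)) tz' (iter_commute hs).
congr prepend; rewrite -{1}w0 -hz -smu; apply/initial_wordP => i im.
apply: nP => j jn; rewrite -(prepend_iter (size nu) z) tz /= /prepend !size_mkseq.
have [ijm|ijm] := ltnP (i + j) (size nu); first by apply: set_nth_default; rewrite size_mkseq.
by rewrite !nth_default ?size_mkseq// !val_iter_sigma; apply: exy; lia.
Qed.

End SlidingBlock.

(** * The shift of the cover is a local homeomorphism *)

Section Branches.
Variables (A : finType) (X : shift_space A).
Implicit Types (x y : points X) (s t : cover_space X) (a : A).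

Lemma coord_clopen i (E : set (classes X i)) :
  clopen [set t : cover_space X | E (coord t i)].
Proof.
have H (E' : set (classes X i)) : open [set t : cover_space X | E' (coord t i)].
  by rewrite openE => t Et; apply/nbhs_coord; exists i => t' e; rewrite /= e.
by split=> //; rewrite -openC; exact: H (~` E).
Qed.

Definition prependable a y : Prop := shift_set X (prepend [:: a] (val y)).

(** The inverse branch of the shift for the letter [a], made total by the identity
    so that it can be extended to the cover; whether [a] can be prepended to [y]
    is decided by the class of [y] for the index [(0, 1)]. *)
Definition push a y : points X :=
  if pselect (prependable a y) is left Xay then to_point Xay else y.

Lemma val_push a y : prependable a y -> val (push a y) = prepend [:: a] (val y).
Proof. by rewrite /push; case: pselect. Qed.

Lemma push_out a y : ~ prependable a y -> push a y = y.
Proof. by rewrite /push; case: pselect. Qed.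

Lemma sigma_push a y : prependable a y -> sigma (push a y) = y.
Proof. by move=> /val_push/prepend_decomposition[]. Qed.

Lemma prependable_sigma x : prependable (val x 0%N) (sigma x).
Proof. by rewrite /prependable (prepend_iter 1 x); exact: set_mem (valP x). Qed.

Lemma push_sigma x : push (val x 0%N) (sigma x) = x.
Proof.
by apply: val_inj; rewrite val_push ?(prepend_iter 1)//; exact: prependable_sigma.
Qed.

Lemma prependable_sim a x y k l : (k < l)%N -> sim k l x y ->
  prependable a x <-> prependable a y.
Proof.
move=> kl s; have /sim_pastsP[_] : sim 0 1 x y.
  by apply: (@sim_le _ _ (exist _ (0, 1)%N isT) (exist _ (k, l) (ltnW kl))) s;
    rewrite /index_le /=; lia.
by apply.
Qed.

(** The index changes from [(k, l)] to [(k, l.+1)] because a past [mu] of [a y]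
    corresponds to the past [mu a] of [y]. *)
Lemma push_sim_continuous a : sim_continuous (push a).
Proof.
move=> [[k l] /= kl]; exists (exist _ (k, l.+1) (leqW kl)) => /= x y s.
have kl1 : (k < l.+1)%N by [].
have [Xx|nXx] := pselect (prependable a x); last first.
  have nXy : ~ prependable a y by move=> /(prependable_sim a kl1 s).
  rewrite !push_out//.
  by apply: (@sim_le _ _ (exist _ (k, l) kl) (exist _ (k, l.+1) (leqW kl))) s;
    rewrite /index_le /=; lia.
have Xy := (prependable_sim a kl1 s).1 Xx.
apply/sim_pastsP; case: k kl kl1 s => [|k] kl kl1 s.
  split=> // mu mul; rewrite /= !val_push// -!prepend_cat.
  by have /sim_pastsP[_] := s; apply; rewrite size_cat addn1.
have {}kl1 : (k <= l)%N by exact: ltnW.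
have /sim_pastsP[_ E] : sim k l x y.
  by apply: (@sim_le _ _ (exist _ (k, l) kl1) (exist _ (k.+1, l.+1) (leqW kl))) s;
    rewrite /index_le /=; lia.
split; last by move=> mu mul; rewrite !iterSr !sigma_push//; exact: E.
have [/initial_wordP e _] := s; apply/initial_wordP => n nk.
rewrite !val_push// /prepend; case: n nk => // n nk.
by rewrite !nth_default// subn1; apply: e; exact: ltnW.
Qed.

(** [G] extends prepending [a], and [D] is the clopen set of the points to which
    [a] can be prepended.  Both identities hold on embedded points and pass to the
    cover because the conditions are clopen. *)
Lemma sigma_cover_branch a : exists (G : cover_space X -> cover_space X) (D : set (cover_space X)),
  [/\ continuous G, open D,
      forall t, val (pi_cover t) 0%N = a -> D (sigma_cover t) /\ G (sigma_cover t) = t &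
      forall s, D s -> sigma_cover (G s) = s].
Proof.
have [G [cG GE]] := lift_cover (@push_sim_continuous a).
pose i01 : cover_index := exist _ (0, 1)%N isT.
pose D := [set s | prependable a (repr (coord s i01))].
have [oD cD] : clopen D by exact: (coord_clopen [set c | prependable a (repr c)]).
have DE x : D (embed x) <-> prependable a x.
  apply: (@prependable_sim a _ _ 0 1) => //.
  by apply/(class_ofP i01); rewrite [LHS]is_repr_repr.
pose Z := [set t : cover_space X | val (pi_cover t) 0%N = a].
have oZ : open Z.
  rewrite openE => t Zt.
  have : nbhs t [set t' | val (pi_cover t') 0%N = val (pi_cover t) 0%N] :=
    @pi_cover_continuous _ _ t _ (nbhs_coordinate (pi_cover t) 0%N).
  by apply: filterS => t' e; exact: etrans e Zt.
have cS := @sigma_cover_continuous A X.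
exists G, D; split=> //.
- move=> t; rewrite -[X in X -> _]/(Z t) => Zt.
  (* The implication is phrased as membership in a closed set. *)
  suff [|] : (~` Z `|` (@sigma_cover A X @^-1` D `&`
                        [set t | G (sigma_cover t) = t])) t by [].
  move: {Zt} t; apply: embed_dense.
    apply: closedU; first exact: open_closedC.
    apply: closedI; first by apply: preimage_closed => // ? _; exact: cS.
    exact: (closed_eq_pro_discrete (comp_continuous cS cG) (fun t => cvg_id)).
  move=> x; have [Zx|] := pselect (Z (embed x)); last by left.
  have {}Zx : val x 0%N = a by rewrite -(pi_embed x); exact: Zx.
  right; split; rewrite /= sigma_embed.
    by apply/DE; rewrite -Zx; exact: prependable_sigma.
  by rewrite GE -Zx push_sigma.
- move=> s Ds; suff [|] : (~` D `|` [set s | sigma_cover (G s) = s]) s by [].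
  move: {Ds} s; apply: embed_dense.
    apply: closedU; first exact: open_closedC.
    exact: (closed_eq_pro_discrete (comp_continuous cG cS) (fun t => cvg_id)).
  move=> x; have [/DE Dx|] := pselect (D (embed x)); last by left.
  by right; rewrite /= GE sigma_embed sigma_push.
Qed.

End Branches.

Section LocalHomeo.
Variables (A : finType) (X : shift_space A).
Implicit Types (t : cover_space X).
Local Notation sc := (@sigma_cover A X).

Lemma sigma_cover_open (O : set (cover_space X)) : open O -> open (sc @` O).
Proof.
move=> oO; rewrite openE => _ [t Ot <-].
have [G [D [cG oD GD DG]]] := @sigma_cover_branch A X (val (pi_cover t) 0%N).
have [Dt Gt] := GD t erefl.
have nG : nbhs (sc t) (G @^-1` O) by apply: cG; rewrite Gt; exact: open_nbhs_nbhs.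
apply: filterS (filterI nG (open_nbhs_nbhs (conj oD Dt))) => s [/= GsO Ds].
by exists (G s) => //; exact: DG.
Qed.

Lemma sigma_cover_inj t t' : val (pi_cover t) 0%N = val (pi_cover t') 0%N ->
  sc t = sc t' -> t = t'.
Proof.
move=> e st; have [G [D [_ _ GD _]]] := @sigma_cover_branch A X (val (pi_cover t') 0%N).
by have [_ <-] := GD t e; have [_ <-] := GD t' erefl; rewrite st.
Qed.

Lemma iter_sigma_open n (O : set (cover_space X)) : open O -> open (iter n sc @` O).
Proof.
move=> oO; elim: n => [|n IH]; first by rewrite image_id.
suff -> : iter n.+1 sc @` O = sc @` (iter n sc @` O) by exact: sigma_cover_open.
by rewrite image_comp.
Qed.

Lemma iter_sigma_continuous n : continuous (iter n sc).
Proof.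
elim: n => [|n IH]; first by move=> t; exact: cvg_id.
exact: (comp_continuous IH (@sigma_cover_continuous A X)).
Qed.

(** Injectivity of the inverse branches, iterated: a point is recovered from its
    [n]-th iterate and the [n] letters that were dropped. *)
Lemma iter_sigma_inj n t t' :
  initial_word n (pi_cover t) = initial_word n (pi_cover t') ->
  iter n sc t = iter n sc t' -> t = t'.
Proof.
move=> /initial_wordP; elim: n t t' => // n IH t t' e; rewrite !iterSr => st.
apply: sigma_cover_inj; first exact: e.
by apply: IH st => m mn; rewrite !pi_sigma; exact: e.
Qed.

Definition cover_cylinder n t : set (cover_space X) :=
  [set t' | initial_word n (pi_cover t') = initial_word n (pi_cover t)].

Lemma open_cover_cylinder n t : open (cover_cylinder n t).
Proof.
rewrite openE => s /= e; rewrite /cover_cylinder -e.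
have H : nbhs (pi_cover s)
    [set y : points X | initial_word n y = initial_word n (pi_cover s)].
  by apply/nbhs_initial_word; exists n.
exact: (@pi_cover_continuous _ _ s _ H).
Qed.

End LocalHomeo.

(** * The topology of the groupoid *)

Section GroupoidTopology.
Variables (A : finType) (X : shift_space A).
Implicit Types (t : cover_space X) (c : groupoid X).
Local Notation sc := (@sigma_cover A X).

Lemma nbhs_subbase (Z : set (groupoid X)) c : groupoid_subbase Z -> Z c -> nbhs c Z.
Proof.
move=> sZ Zc; rewrite nbhsE; exists Z => //; split=> //.
exists [set Z]; last first.
  by rewrite predeqE => ?; split=> [[_ ->]|] //; exists Z.
move=> _ ->; exists [fset Z]%fset.
  by move=> Z1; rewrite in_fset1 => /eqP ->; exact: mem_set.
by rewrite predeqE => ?; split=> [|??]; [apply|]; rewrite /= inE // =>/eqP->.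
Qed.

Lemma cvg_subbase (F : set_system (groupoid X)) c : Filter F ->
  (forall Z, groupoid_subbase Z -> Z c -> F Z) -> F --> c.
Proof.
move=> FF FZ U /=; rewrite nbhsE => -[_ [[C sC <-] [E CE Ec] sCU]].
rewrite nbhs_filterE; apply: filterS sCU _; apply: (@filterS _ _ _ E).
  by move=> ? ?; exists E.
have /sC [D sD IDE] := CE; rewrite -IDE; apply: filter_bigI => Z DZ.
have /sD := DZ; rewrite inE => sZ; apply: FZ => //.
by move: Ec; rewrite -IDE => /(_ _ DZ).
Qed.

Lemma groupoid_eq c c' : rng c = rng c' -> cocycle c = cocycle c' -> src c = src c' ->
  c = c'.
Proof.
case: c c' => -[[x p] y] h [[[x' p'] y'] h']; rewrite /rng /cocycle /src /= => ex ep ey.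
by apply: val_inj; rewrite /= ex ep ey.
Qed.

(** The subbase only contains sets for which the iterates are injective on [U] and
    [V] and have equal images.  Any [U] and [V] can be shrunk to this situation
    since the shift is a local homeomorphism, so these restrictions can be
    ignored when describing neighbourhoods of an arrow. *)
Lemma nbhs_arrow c i j (U V : set (cover_space X)) :
  cocycle c = i%:Z - j%:Z -> iter i sc (rng c) = iter j sc (src c) ->
  nbhs (rng c) U -> nbhs (src c) V ->
  nbhs c [set c' : groupoid X | [/\ U (rng c'), V (src c'), cocycle c' = i%:Z - j%:Z &
                       iter i sc (rng c') = iter j sc (src c')]].
Proof.
move=> ec sij; rewrite (nbhsE (rng c)) (nbhsE (src c)) => -[U1 [oU1 U1c] U1U] [V1 [oV1 V1c] V1V].
pose U2 := U1 `&` cover_cylinder i (rng c).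
pose V2 := V1 `&` cover_cylinder j (src c).
have oU2 : open U2 by apply: openI => //; exact: open_cover_cylinder.
have oV2 : open V2 by apply: openI => //; exact: open_cover_cylinder.
(* The common image, to which both sides are cut down. *)
pose W := iter i sc @` U2 `&` iter j sc @` V2.
have oW : open W by apply: openI; exact: iter_sigma_open.
pose U3 := U2 `&` iter i sc @^-1` W; pose V3 := V2 `&` iter j sc @^-1` W.
have oI n O : open O -> open (O `&` iter n sc @^-1` W).
  move=> oO; apply: openI => //; apply: open_comp => // t _; exact: iter_sigma_continuous.
have Wc : W (iter i sc (rng c)).
  by split; [exists (rng c)|exists (src c)].
pose Z := [set c' : groupoid X | [/\ U3 (rng c'), V3 (src c'), cocycle c' = i%:Z - j%:Z &
                    iter i sc (rng c') = iter j sc (src c')]].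
have sZ : groupoid_subbase Z.
  exists U3, V3, i, j; split=> //; split; [exact: oI|exact: oI| | |].
  - move=> t t' /set_mem[[_ /= e] _] /set_mem[[_ /= e'] _].
    by apply: iter_sigma_inj; rewrite e e'.
  - move=> t t' /set_mem[[_ /= e] _] /set_mem[[_ /= e'] _].
    by apply: iter_sigma_inj; rewrite e e'.
  - transitivity W; apply/seteqP; split.
    + by move=> _ [t [_ Wt] <-].
    + by move=> w [[t U2t tw] V2w]; exists t => //; split=> //=; rewrite tw; split=> //; exists t.
    + by move=> w [U2w [t V2t tw]]; exists t => //; split=> //=; rewrite tw; split=> //; exists t.
    + by move=> _ [t [_ Wt] <-].
have Zc : Z c by split=> //; split=> //; rewrite /= -sij.
apply: filterS (nbhs_subbase sZ Zc).
by move=> c' [[[/U1U ? _] _] [[/V1V ? _] _] ? ?].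
Qed.

Lemma arrow_data c : exists i j : nat, cocycle c = i%:Z - j%:Z /\
  iter i sc (rng c) = iter j sc (src c).
Proof. exact: set_mem (arrowP c). Qed.

Lemma rng_continuous : continuous (@rng A X).
Proof.
move=> c U nU; have [i [j [ec sij]]] := arrow_data c.
by apply: filterS (nbhs_arrow ec sij nU filterT) => c' [].
Qed.

Lemma src_continuous : continuous (@src A X).
Proof.
move=> c U nU; have [i [j [ec sij]]] := arrow_data c.
by apply: filterS (nbhs_arrow ec sij filterT nU) => c' [].
Qed.

Lemma nbhs_cocycle c : nbhs c [set c' : groupoid X | cocycle c' = cocycle c].
Proof.
have [i [j [ec sij]]] := arrow_data c.
by apply: filterS (nbhs_arrow ec sij filterT filterT) => c' []; rewrite ec.
Qed.

(** The equivalence relation of having the same [n]-th iterate, as a subgroupoid.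
    For [n = 0] it is the space of units, for [n = 1] the support of the element
    [tau 1]. *)
Definition tail_arrows n : set (groupoid X) :=
  [set c | cocycle c = 0 /\ iter n sc (rng c) = iter n sc (src c)].

Lemma tail_arrows_clopen n : clopen (tail_arrows n).
Proof.
split.
  rewrite openE => c [c0 sc0].
  have e0 : cocycle c = n%:Z - n%:Z by rewrite subrr.
  by apply: filterS (nbhs_arrow e0 sc0 filterT filterT) => c' []; rewrite subrr.
apply: closedI.
  rewrite -openC openE => c /= nc; apply: filterS (nbhs_cocycle c) => c' /= ec.
  by rewrite /= ec.
exact: (closed_eq_pro_discrete
  (comp_continuous rng_continuous (@iter_sigma_continuous A X n))
  (comp_continuous src_continuous (@iter_sigma_continuous A X n))).
Qed.

Definition tail_pairs n : set (cover_space X * cover_space X) :=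
  [set p | iter n sc p.1 = iter n sc p.2].

(** A parametrization of [tail_arrows n] by the compact set [tail_pairs n], on
    which the default value does not occur. *)
Definition tail_arrow (p : cover_space X * cover_space X) : groupoid X :=
  if pselect (groupoid_set (p.1, 0, p.2)) is left h then Arrow (mem_set h) else gunit p.1.

Lemma tail_arrowE n p : tail_pairs n p ->
  [/\ rng (tail_arrow p) = p.1, cocycle (tail_arrow p) = 0 & src (tail_arrow p) = p.2].
Proof.
move=> np; rewrite /tail_arrow; case: pselect => // -[].
by exists n, n; rewrite subrr.
Qed.

Lemma tail_pairs_compact n : compact (tail_pairs n).
Proof.
apply: (@subclosed_compact _ _ ([set: cover_space X] `*` [set: cover_space X])).
- have cf : continuous (@fst (cover_space X) (cover_space X)) by move=> p; exact: cvg_fst.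
  have cs : continuous (@snd (cover_space X) (cover_space X)) by move=> p; exact: cvg_snd.
  exact: (closed_eq_pro_discrete
    (comp_continuous cf (@iter_sigma_continuous A X n))
    (comp_continuous cs (@iter_sigma_continuous A X n))).
- by apply: compact_setX; exact: compact_cover_space.
- by [].
Qed.

(** The topology of the groupoid restricts on [tail_arrows n] to that of the
    product of two copies of the cover: two points close to [x] and [z] with the
    same [n]-th iterate have the same [i]-th iterate when [x] and [z] do, by
    injectivity of the [n]-th iterate near the common [i]-th iterate. *)
Lemma tail_arrow_continuous n : {within tail_pairs n, continuous tail_arrow}.
Proof.
apply/subspace_continuousP => -[x z] np; apply: cvg_subbase.
move=> Z [U [V [i [j [[oU oV _ _ _] ->]]]]].
have [e1 e2 e3] := tail_arrowE np; rewrite /= e1 e2 e3 => -[/= Ux Vz ij sij].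
have {}ij : i = j by lia.
subst j.
pose N y := [set t | cover_cylinder n (iter i sc y) (iter i sc t)].
have nN y : nbhs y (N y).
  apply: (@iter_sigma_continuous _ _ i y (cover_cylinder n (iter i sc y))).
  by apply: open_nbhs_nbhs; split=> //; exact: open_cover_cylinder.
have nW : nbhs (x, z) ((U `&` N x) `*` (V `&` N z)).
  by exists (U `&` N x, V `&` N z) => //; split; apply: filterI => //;
    exact: open_nbhs_nbhs.
apply: filterS nW => -[x' z'] [/= [Ux' wx] [Vz' wz]] np' /=.
have [e1' e2' e3'] := tail_arrowE np'; rewrite /= e1' e2' e3'; split=> //; first by rewrite subrr.
apply: (@iter_sigma_inj _ _ n); first by rewrite wx wz sij.
by rewrite -!iterD addnC !iterD np'.
Qed.

Lemma tail_arrows_compact n : compact (tail_arrows n).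
Proof.
have -> : tail_arrows n = tail_arrow @` tail_pairs n.
  apply/seteqP; split=> [c [c0 sc0]|_ [p np <-]].
    exists (rng c, src c) => //.
    by have [e1 e2 e3] := @tail_arrowE n (rng c, src c) sc0;
      apply: groupoid_eq; rewrite ?e1 ?e2 ?e3 ?c0.
  by have [e1 e2 e3] := tail_arrowE np; split=> //; rewrite e1 e3.
by apply: continuous_compact; [exact: tail_arrow_continuous|exact: tail_pairs_compact].
Qed.

End GroupoidTopology.

(** * Products with the canonical generators *)

Section Sums.
Variables (R : realType) (T : choiceType).

Lemma esum_single (D : set T) (a : T -> \bar R) t0 :
  D t0 -> (0 <= a t0)%E -> (forall t, D t -> t <> t0 -> a t = 0%E) ->
  \esum_(t in D) a t = a t0.
Proof.
move=> Dt0 a0 az; rewrite -[RHS]esum_set1//.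
have -> : [set t0] = D `&` [set t0] by apply/seteqP; split=> [t ->//|t []].
rewrite esum_mkcondr; apply: eq_esum => t Dt.
by case: ifPn => //; rewrite notin_setE => /= /az ->.
Qed.

Lemma rsum_single (D : set T) (f : T -> R) t0 :
  D t0 -> (forall t, D t -> t <> t0 -> f t = 0) -> rsum D f = f t0.
Proof.
move=> Dt0 fz; rewrite /rsum !(@esum_single _ _ t0)//.
- by have /(congr1 (fun g => g t0)) := funrposBneg f.
- by rewrite lee_fin funrneg_ge0.
- by move=> t Dt tt0; rewrite /funrneg fz// oppr0 maxxx.
- by rewrite lee_fin funrpos_ge0.
- by move=> t Dt tt0; rewrite /funrpos fz// maxxx.
Qed.

Lemma csum_single (D : set T) (f : T -> R[i]) t0 :
  D t0 -> (forall t, D t -> t <> t0 -> f t = 0) -> csum D f = f t0.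
Proof.
move=> Dt0 fz; rewrite /csum !(@rsum_single _ _ t0) => //; try by case: (f t0).
- by move=> t Dt tt0; rewrite fz.
- by move=> t Dt tt0; rewrite fz.
Qed.

Lemma eq_csum (D : set T) (f g : T -> R[i]) :
  (forall t, D t -> f t = g t) -> csum D f = csum D g.
Proof.
move=> fg; rewrite /csum /rsum.
by congr (Complex (fine _ - fine _) (fine _ - fine _)); apply: eq_esum => t Dt;
  rewrite /funrpos /funrneg /= fg.
Qed.

Lemma csum0 (D : set T) : csum D (fun=> 0 : R[i]) = 0.
Proof.
rewrite /csum /rsum !esum1 ?subrr// => t _; rewrite /funrpos /funrneg /=.
all: by rewrite ?oppr0 maxxx.
Qed.

End Sums.

Lemma reindex_csum (R : realType) (T U : choiceType) (P : set T) (Q : set U) (e : T -> U)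
    (f : U -> R[i]) :
  set_bij P Q e -> csum Q f = csum P (f \o e).
Proof. by move=> be; rewrite /csum /rsum !(reindex_esum P Q e). Qed.

Section Algebra.
Variables (R : realType) (A : finType) (X : shift_space A).
Implicit Types (c : groupoid X) (t : cover_space X) (f y : groupoid X -> R[i]).
Implicit Types (d : cover_space X -> R[i]) (a : A).
Local Notation sc := (@sigma_cover A X).

Lemma factorizationsP c (ab : groupoid X * groupoid X) :
  factorizations c ab <-> [/\ src ab.1 = rng ab.2, rng ab.1 = rng c,
    cocycle ab.1 + cocycle ab.2 = cocycle c & src ab.2 = src c].
Proof.
split=> [[h <-]//|[h e1 e2 e3]]; exists h; exact: groupoid_eq.
Qed.

Lemma shift_arrow_subproof t : (t, 1, sc t) \in @groupoid_set A X.
Proof. by apply/mem_set; exists 1%N, 0%N. Qed.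

Definition shift_arrow t : groupoid X := Arrow (shift_arrow_subproof t).

Lemma gen_cylinder a c : gen R a c != 0 -> c = shift_arrow (rng c).
Proof.
rewrite /gen indicE; case: (boolP (_ \in _)) => [/set_mem[c1 sc1 _] _|]; last by rewrite eqxx.
exact: groupoid_eq.
Qed.

Lemma gen_shift_arrow a t : gen R a (shift_arrow t) = (val (pi_cover t) 0%N == a)%:R.
Proof.
rewrite /gen indicE; congr (_%:R); congr nat_of_bool.
by apply/idP/eqP => [/set_mem[]//|e]; apply/mem_set.
Qed.

(** An arrow factors in at most one way through the support of a generator, so
    the sum has one nonzero term. *)
Lemma convolution_gen a y c c2 :
  rng c2 = sc (rng c) -> cocycle c = 1 + cocycle c2 -> src c2 = src c ->
  convolution (gen R a) y c = (val (pi_cover (rng c)) 0%N == a)%:R * y c2.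
Proof.
move=> e1 e2 e3; rewrite -gen_shift_arrow /convolution.
rewrite (@csum_single _ _ _ _ (shift_arrow (rng c), c2))//.
  by apply/factorizationsP.
move=> [b b2] /factorizationsP[/= e1' e2' e3' e4'] nb /=.
have [->|/gen_cylinder eb] := eqVneq (gen R a b) 0; first by rewrite mul0r.
case: nb; rewrite eb e2'; congr pair; apply: groupoid_eq.
- by rewrite -e1' eb e1 -e2'.
- by move: e3'; rewrite e2 eb => /addrI.
- by rewrite e4' e3.
Qed.

Lemma convolution_star_gen a y c c1 :
  rng c1 = rng c -> cocycle c1 = cocycle c + 1 -> src c1 = sc (src c) ->
  convolution y (star (gen R a)) c = (val (pi_cover (src c)) 0%N == a)%:R * y c1.
Proof.
move=> e1 e2 e3; rewrite /convolution.
rewrite (@csum_single _ _ _ _ (c1, ginv (shift_arrow (src c))))//=.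
- rewrite mulrC /star; have -> : ginv (ginv (shift_arrow (src c))) = shift_arrow (src c).
    by apply: groupoid_eq; rewrite //= /cocycle /= opprK.
  by rewrite gen_shift_arrow conjC_nat.
- by apply/factorizationsP; split=> //=; rewrite e2 /cocycle /= addrK.
move=> [b1 b] /factorizationsP[/= e1' e2' e3' e4'] nb /=.
have [e0|/gen_cylinder eb] := eqVneq (gen R a (ginv b)) 0.
  by rewrite /star e0 conjC0 mulr0.
have eb' : b = ginv (shift_arrow (src c)).
  have -> : b = ginv (ginv b) by apply: groupoid_eq; rewrite //= /cocycle /= opprK.
  by rewrite eb [rng (ginv b)]e4'.
case: nb; rewrite eb'; congr pair; apply: groupoid_eq; first by rewrite e1.
- by rewrite e2 -e3' eb' /= /cocycle /= subrK.
- by rewrite e1' eb' e3.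
Qed.

Lemma gen_sandwich a b y c :
  convolution (convolution (gen R b) y) (star (gen R a)) c =
  (val (pi_cover (src c)) 0%N == a)%:R *
  ((val (pi_cover (rng c)) 0%N == b)%:R * y (eps c)).
Proof.
have h : composable c (shift_arrow (src c)) by [].
by rewrite (@convolution_star_gen _ _ _ (gmul h))// (@convolution_gen _ _ _ (eps c))//=
  /cocycle /= addrC.
Qed.

Lemma sum_indicator (a0 : A) (F : A -> R[i]) : \sum_(a : A) (a0 == a)%:R * F a = F a0.
Proof.
rewrite (bigD1 a0)//= eqxx mul1r big1 ?addr0// => a /negPf aa0.
by rewrite eq_sym aa0 mul0r.
Qed.

(** Summing over [a] and [b] removes the conditions on the first letters that
    [gen_sandwich] imposes. *)
Lemma tauE y c : tau y c = y (eps c).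
Proof.
rewrite /tau fct_sumE; under eq_bigr => a _.
  rewrite fct_sumE; under eq_bigr => b _ do rewrite gen_sandwich.
  rewrite -mulr_sumr; over.
by rewrite sum_indicator sum_indicator.
Qed.

Lemma phiE y c : phi y c =
  (val (pi_cover (src c)) 0%N == val (pi_cover (rng c)) 0%N)%:R * y (eps c).
Proof.
rewrite /phi fct_sumE; under eq_bigr => a _ do rewrite gen_sandwich.
by rewrite sum_indicator eq_sym.
Qed.

Lemma on_units_gunit d t : on_units d (gunit t) = d t.
Proof. by rewrite /on_units; case: asboolP => // -[]. Qed.

Lemma on_units_out d c : c <> gunit (rng c) -> on_units d c = 0.
Proof. by rewrite /on_units; case: asboolP. Qed.

(** The sum over the diagonal [a = b] keeps the condition that source and range
    have the same first letter, and two such points with the same shift are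
    equal. *)
Lemma phi_on_units d : phi (on_units d) = on_units (d \o sc).
Proof.
apply/funext => c; rewrite phiE.
have [->|nc] := pselect (c = gunit (rng c)).
  rewrite eqxx mul1r on_units_gunit -[RHS](on_units_gunit d).
  by congr on_units; exact: groupoid_eq.
rewrite (on_units_out _ nc); case: eqP => [e|]; rewrite ?mul0r// mul1r.
apply: on_units_out => /[dup] /(congr1 (@cocycle A X)) c0 /(congr1 (@src A X)) /= s.
by apply: nc; apply: groupoid_eq => //; apply: sigma_cover_inj.
Qed.

Lemma convolution_on_units d y c : convolution (on_units d) y c = d (rng c) * y c.
Proof.
rewrite /convolution (@csum_single _ _ _ _ (gunit (rng c), c)) ?on_units_gunit//.
  by apply/factorizationsP; rewrite /= add0r.
move=> [b b2] /factorizationsP[/= e1 e2 e3 e4] nb /=.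
have [eb|/on_units_out ->] := pselect (b = gunit (rng b)); last by rewrite mul0r.
case: nb; rewrite eb e2; congr pair; apply: groupoid_eq => //.
  by rewrite -e1 eb.
by rewrite -e3 eb add0r.
Qed.

(** On the support of [tau 1] both ends of an arrow have the same shift, so
    [d \o sc] may be evaluated at the range. *)
Lemma tau_on_units d :
  tau (on_units d) = convolution (on_units (d \o sc)) (tau (on_units (fun=> 1))).
Proof.
apply/funext => c; rewrite convolution_on_units !tauE /on_units.
by case: asboolP; rewrite ?mulr1 ?mulr0.
Qed.

End Algebra.

(** * Compactly supported elements *)

Section Membership.
Variables (R : realType) (A : finType) (X : shift_space A).
Implicit Types (c : groupoid X) (d : cover_space X -> R[i]).
Local Notation sc := (@sigma_cover A X).

(** The form shared by [on_units d] and [tau 1]: a continuous function of the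
    range, cut off outside a compact open set. *)
Lemma Cc_cutoff (K : set (groupoid X)) d (f : groupoid X -> R[i]) :
  clopen K -> compact K -> continuous (d : cover_space X -> R[i]^o) ->
  (forall c, K c -> f c = d (rng c)) -> (forall c, ~ K c -> f c = 0) -> Cc f.
Proof.
move=> [oK cK] kK cd fK fK'; split.
  move=> c U; have [Kc|nKc] := pselect (K c).
    rewrite /= fK// => nU; have nc : nbhs c ((d \o @rng A X) @^-1` U).
      exact: (@comp_continuous _ _ R[i]^o _ _ (@rng_continuous A X) cd c U nU).
    by apply: filterS (filterI (open_nbhs_nbhs (conj oK Kc)) nc) => c' [/fK e]; rewrite /= e.
  rewrite /= fK'// => /nbhs_singleton U0.
  have onK : open (~` K) by rewrite openC.
  by apply: filterS (open_nbhs_nbhs (conj onK nKc)) => c' /fK' /= ->.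
apply: (subclosed_compact _ kK); first exact: closed_closure.
rewrite [X in _ `<=` X](closure_id K).1//; apply: closureS => c /=.
by have [//|/fK' ->] := pselect (K c); rewrite eqxx.
Qed.

Lemma Cc_on_units d : continuous (d : cover_space X -> R[i]^o) -> Cc (on_units d).
Proof.
move=> cd; apply: (@Cc_cutoff (tail_arrows 0) d) => //.
- exact: tail_arrows_clopen.
- exact: tail_arrows_compact.
- by move=> c [c0 /= e]; rewrite -on_units_gunit; congr on_units; exact: groupoid_eq.
- move=> c nc; apply: on_units_out => e; apply: nc.
  by split; rewrite e.
Qed.

(** [tau 1] is the indicator function of [tail_arrows 1]. *)
Lemma Cc_tau1 : Cc (tau (on_units (fun _ : cover_space X => 1 : R[i]))).
Proof.
apply: (@Cc_cutoff (tail_arrows 1) (fun=> 1)) => //.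
- exact: tail_arrows_clopen.
- exact: tail_arrows_compact.
- exact: (@cst_continuous _ R[i]^o 1).
- move=> c [c0 /= e]; rewrite tauE.
  have -> : eps c = gunit (sc (rng c)) by apply: groupoid_eq => //; exact: esym e.
  by rewrite on_units_gunit.
- move=> c nc; rewrite tauE; apply: on_units_out => e; apply: nc.
  split; first by move/(congr1 (@cocycle A X)): e.
  by move/(congr1 (@src A X)): e.
Qed.

Lemma l2norm0 : l2norm (fun _ : groupoid X => 0 : R[i]) = 0%E.
Proof.
by rewrite /l2norm esum1 ?sqrte0// => c _; rewrite normr0 /= expr0n.
Qed.

Lemma Cc_OX (f : groupoid X -> R[i]) : Cc f -> OX f.
Proof.
move=> Cf e e0; exists f; split=> //.
apply: ge_ereal_sup => _ [xi _ <-].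
have -> : convolution (f \- f) xi = fun=> 0.
  apply/funext => c; rewrite /convolution -[RHS](csum0 R (factorizations c)).
  by apply: eq_csum => ab _; rewrite /= subrr mul0r.
by rewrite l2norm0 lee_fin ltW.
Qed.

End Membership.

(** * Transport along a conjugacy of covers *)

Definition homeo_sym (T U : topologicalType) (h : homeo T U) : homeo U T :=
  Homeo (@homeo_invK _ _ h) (@homeoK _ _ h) (@homeo_inv_continuous _ _ h)
    (@homeo_continuous _ _ h).

Lemma homeo_symE (T U : topologicalType) (h : homeo T U) u :
  homeo_sym h u = homeo_inv h u.
Proof. reflexivity. Qed.

Lemma conjugacy_sym (T U : topologicalType) (s : T -> T) (s' : U -> U) (h : homeo T U) :
  is_conjugacy s s' h -> is_conjugacy s' s (homeo_sym h).
Proof.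
move=> hs u; apply: (can_inj (@homeoK _ _ h)); rewrite hs /=.
by rewrite !homeo_invK.
Qed.

Lemma intertwine_sym (S T U V : topologicalType) (p : S -> U) (q : T -> V)
    (h : homeo U V) (th : homeo S T) :
  (forall t, h (p t) = q (th t)) ->
  forall t, homeo_sym h (q t) = p (homeo_sym th t).
Proof.
move=> hp t; apply: (can_inj (@homeoK _ _ h)).
by rewrite hp !homeo_symE !homeo_invK.
Qed.

Lemma iter_conjugacy_eq (T U : topologicalType) (s : T -> T) (s' : U -> U) (h : homeo T U) :
  is_conjugacy s s' h ->
  forall i j x y, iter i s' (h x) = iter j s' (h y) <-> iter i s x = iter j s y.
Proof.
move=> hs i j x y; rewrite -!(iter_commute hs).
by split=> [/(can_inj (@homeoK _ _ h))|->].
Qed.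

Section ArrowMap.
Variables (A B : finType) (X : shift_space A) (Y : shift_space B).
Variables (th : homeo (cover_space X) (cover_space Y)).
Hypothesis ths : is_conjugacy (@sigma_cover A X) (@sigma_cover B Y) th.

Lemma arrow_map_subproof (c : groupoid X) :
  (th (rng c), cocycle c, th (src c)) \in @groupoid_set B Y.
Proof.
have [i [j [e s]]] := arrow_data c; apply/mem_set; exists i, j; split=> //=.
exact/(iter_conjugacy_eq ths).
Qed.

Definition arrow_map (c : groupoid X) : groupoid Y := Arrow (arrow_map_subproof c).

Lemma rng_arrow_map c : rng (arrow_map c) = th (rng c). Proof. reflexivity. Qed.

Lemma cocycle_arrow_map c : cocycle (arrow_map c) = cocycle c. Proof. reflexivity. Qed.

Lemma src_arrow_map c : src (arrow_map c) = th (src c). Proof. reflexivity. Qed.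

Definition arrow_mapE := (rng_arrow_map, cocycle_arrow_map, src_arrow_map).

Lemma arrow_map_gunit t : arrow_map (gunit t) = gunit (th t).
Proof. by apply: groupoid_eq; reflexivity. Qed.

Lemma arrow_map_eps c : arrow_map (eps c) = eps (arrow_map c).
Proof. by apply: groupoid_eq; [exact: ths|reflexivity|exact: ths]. Qed.

Lemma arrow_map_ginv c : arrow_map (ginv c) = ginv (arrow_map c).
Proof. by apply: groupoid_eq; reflexivity. Qed.

(** By [nbhs_arrow] it suffices that [th] is continuous: the preimage of a
    subbasic set contains a neighbourhood of the same shape. *)
Lemma arrow_map_continuous : continuous arrow_map.
Proof.
move=> c; have FF : Filter (arrow_map @ nbhs c) by exact: fmap_filter.
apply: cvg_subbase => Z [U [V [i [j [[oU oV _ _ _] ->]]]]] [].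
rewrite !arrow_mapE => Uc Vc ec /(iter_conjugacy_eq ths) sij.
have nU : nbhs (rng c) (th @^-1` U).
  exact: (@homeo_continuous _ _ th (rng c) U (open_nbhs_nbhs (conj oU Uc))).
have nV : nbhs (src c) (th @^-1` V).
  exact: (@homeo_continuous _ _ th (src c) V (open_nbhs_nbhs (conj oV Vc))).
apply: (@filterS _ (nbhs c) _ _ _ _ (nbhs_arrow ec sij nU nV)).
move=> c' [Uc' Vc' ec' sij']; rewrite /preimage /mkset !arrow_mapE.
split; [exact: Uc'|exact: Vc'|exact: ec'|exact/(iter_conjugacy_eq ths)].
Qed.

End ArrowMap.

Lemma arrow_mapK (A B : finType) (X : shift_space A) (Y : shift_space B)
  (th : homeo (cover_space X) (cover_space Y))
  (ths : is_conjugacy (@sigma_cover A X) (@sigma_cover B Y) th) :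
  cancel (arrow_map ths) (arrow_map (conjugacy_sym ths)).
Proof.
by move=> c; apply: groupoid_eq; rewrite !arrow_mapE ?homeo_symE ?homeoK; reflexivity.
Qed.

Lemma arrow_map_symK (A B : finType) (X : shift_space A) (Y : shift_space B)
  (th : homeo (cover_space X) (cover_space Y))
  (ths : is_conjugacy (@sigma_cover A X) (@sigma_cover B Y) th) :
  cancel (arrow_map (conjugacy_sym ths)) (arrow_map ths).
Proof.
by move=> c; apply: groupoid_eq; rewrite !arrow_mapE ?homeo_symE ?homeo_invK; reflexivity.
Qed.

Section Pullback.
Variables (R : realType) (A B : finType) (X : shift_space A) (Y : shift_space B).
Variables (th : homeo (cover_space X) (cover_space Y)).
Hypothesis ths : is_conjugacy (@sigma_cover A X) (@sigma_cover B Y) th.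
Local Notation psi := (arrow_map ths).
Implicit Types (f g : groupoid Y -> R[i]).

Definition pullback f : groupoid X -> R[i] := f \o psi.

Lemma arrow_map_factorizations c :
  set_bij (factorizations c) (factorizations (psi c)) (fun ab => (psi ab.1, psi ab.2)).
Proof.
split.
- move=> [a b] /factorizationsP[/= e1 e2 e3 e4]; apply/factorizationsP.
  by rewrite /= !arrow_mapE e1 e2 e3 e4.
- move=> [a b] [a' b'] _ _ eab; have := congr1 snd eab; have := congr1 fst eab.
  by move=> /= /(can_inj (arrow_mapK ths)) -> /(can_inj (arrow_mapK ths)) ->.
- move=> [a b] /factorizationsP[]; rewrite /= !arrow_mapE => e1 e2 e3 e4.
  exists (arrow_map (conjugacy_sym ths) a, arrow_map (conjugacy_sym ths) b).
    apply/factorizationsP; rewrite /= !arrow_mapE e1 e2 e3 e4 !homeo_symE !homeoK.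
    by split; reflexivity.
  by rewrite /= !arrow_map_symK.
Qed.

Lemma convolution_pullback f g : convolution (pullback f) (pullback g) = pullback (convolution f g).
Proof.
apply/funext => c; rewrite /pullback /= /convolution.
by rewrite [RHS](reindex_csum _ (arrow_map_factorizations c)).
Qed.

Lemma star_pullback f : star (pullback f) = pullback (star f).
Proof. by apply/funext => c; rewrite /star /pullback /= arrow_map_ginv. Qed.

Lemma on_units_pullback (d : cover_space Y -> R[i]) :
  pullback (on_units d) = on_units (d \o th).
Proof.
apply/funext => c; rewrite /pullback /=.
have [->|nc] := pselect (c = gunit (rng c)).
  by rewrite arrow_map_gunit !on_units_gunit.
rewrite (on_units_out _ nc) on_units_out// => e; apply: nc.
by apply: (can_inj (arrow_mapK ths)); rewrite e arrow_map_gunit; reflexivity.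
Qed.

Lemma cond_exp_pullback f : pullback (cond_exp f) = cond_exp (pullback f).
Proof.
rewrite /cond_exp on_units_pullback; congr on_units; apply/funext => t /=.
by rewrite /pullback /= arrow_map_gunit.
Qed.

Lemma gauge_pullback z f : pullback (gauge z f) = gauge z (pullback f).
Proof. reflexivity. Qed.

Lemma tau_pullback f : pullback (tau f) = tau (pullback f).
Proof.
apply/funext => c; rewrite tauE /pullback /= tauE arrow_map_eps.
reflexivity.
Qed.

(** Off the diagonal [phi] depends on which points share their first letter, and
    [th] need not preserve this relation. *)
Lemma phi_pullback d : DX d -> pullback (phi d) = phi (pullback d).
Proof.
move=> [d' _ <-]; rewrite phi_on_units !on_units_pullback phi_on_units.
by congr on_units; apply/funext => t /=; rewrite ths.
Qed.

Lemma l2norm_pullback f : l2norm (pullback f) = l2norm f.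
Proof.
rewrite /l2norm [in RHS](reindex_esum [set: groupoid X] _ psi)//.
split=> //; first by move=> c c' _ _; exact: (can_inj (arrow_mapK ths)).
by move=> c _; exists (arrow_map (conjugacy_sym ths) c) => //; exact: arrow_map_symK.
Qed.

Lemma pullback_DX d : DX d -> DX (pullback d).
Proof.
move=> [d' cd <-]; exists (d' \o th); last by rewrite on_units_pullback.
exact: (@comp_continuous _ _ R[i]^o _ _ (@homeo_continuous _ _ th) cd).
Qed.

Lemma pullback_Cc f : Cc f -> Cc (pullback f).
Proof.
move=> [cf kf]; split.
  exact: (@comp_continuous _ _ R[i]^o _ _ (@arrow_map_continuous _ _ _ _ _ ths) cf).
pose K := closure [set c | f c != 0].
have cpK : closed (psi @^-1` K).
  apply: preimage_closed; last exact: closed_closure.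
  by move=> c _; exact: arrow_map_continuous.
apply: (@subclosed_compact _ _ (psi @^-1` K)); first exact: closed_closure.
  have -> : psi @^-1` K = arrow_map (conjugacy_sym ths) @` K.
    apply/seteqP; split=> [c Kc|_ [c Kc <-]]; last by rewrite /= arrow_map_symK.
    by exists (psi c) => //; exact: arrow_mapK.
  apply: continuous_compact => //; apply: continuous_subspaceT.
  exact: arrow_map_continuous.
rewrite [X in _ `<=` X](closure_id _).1//; apply: closureS => c /= fc.
exact: subset_closure.
Qed.

End Pullback.

Section Isomorphism.
Variables (R : realType) (A B : finType) (X : shift_space A) (Y : shift_space B).
Variables (th : homeo (cover_space X) (cover_space Y)).
Hypothesis ths : is_conjugacy (@sigma_cover A X) (@sigma_cover B Y) th.
Local Notation psi := (arrow_map ths).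
Local Notation psi' := (arrow_map (conjugacy_sym ths)).
Local Notation pull := (@pullback R A B X Y th ths).
Local Notation pull' := (@pullback R B A Y X _ (conjugacy_sym ths)).

Lemma pullbackK f : pull' (pull f) = f.
Proof. by apply/funext => c; rewrite /pullback /= arrow_map_symK. Qed.

Lemma pullbackKV f : pull (pull' f) = f.
Proof. by apply/funext => c; rewrite /pullback /= arrow_mapK. Qed.

Lemma finite_vectors_pullback t xi :
  finite_vectors t xi -> finite_vectors (th t) (pull' xi).
Proof.
move=> [fin sub]; split.
  apply: (@sub_finite_set _ _ (psi @` [set c | xi c != 0])); last exact: finite_image.
  by move=> c xic; exists (psi' c) => //; exact: arrow_map_symK.
move=> c /sub /= <-; rewrite src_arrow_map homeo_symE homeo_invK; reflexivity.
Qed.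

(** The regular representation at [t] is conjugate to the one at [th t]. *)
Lemma reduced_norm_pullback_le f : (reduced_norm (pull f) <= reduced_norm f)%E.
Proof.
apply: ge_ereal_sup => _ [xi [[t fxi] xi1] <-].
apply: ereal_sup_ubound; exists (pull' xi).
  split; first by exists (th t); exact: finite_vectors_pullback.
  by rewrite l2norm_pullback.
by rewrite -[in RHS](pullbackKV xi) convolution_pullback l2norm_pullback.
Qed.

Lemma pullback_OX f : OX f -> OX (pull f).
Proof.
move=> Of e e0; have [g [Cg fg]] := Of e e0.
exists (pull g); split; first exact: pullback_Cc.
exact: le_trans (reduced_norm_pullback_le (f \- g)) fg.
Qed.

Lemma pullback_star_iso (S : set (groupoid Y -> R[i])) (S' : set (groupoid X -> R[i])) :
  (forall f, S f -> S' (pull f)) -> (forall f, S' f -> S (pull' f)) ->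
  is_star_iso S S' pull.
Proof.
move=> SS' S'S; split.
- split; first exact: SS'.
  + by move=> f g _ _ /(congr1 pull'); rewrite !pullbackK.
  + by move=> f S'f; exists (pull' f); [exact: S'S|exact: pullbackKV].
- by move=> f g _ _; reflexivity.
- by move=> k f _; reflexivity.
- by move=> f g _ _; rewrite convolution_pullback.
- by move=> f _; rewrite star_pullback.
Qed.

Lemma pullback_extends (h : homeo (points X) (points Y)) :
  (forall t, h (pi_cover t) = pi_cover (th t)) -> extends_homeo (homeo_sym h) pull.
Proof.
move=> hpi.
have E (f : points Y -> R[i]) : pull (of_CX f) = of_CX (f \o h).
  by rewrite /of_CX on_units_pullback; congr on_units; apply/funext => t /=; rewrite hpi.
split; last by move=> f _; exact: E.
apply/seteqP; split=> [_ [_ [f cf <-] <-]|_ [f cf <-]].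
  exists (f \o h); last by rewrite E.
  exact: (@comp_continuous _ _ R[i]^o _ _ (@homeo_continuous _ _ h) cf).
exists (of_CX (f \o homeo_inv h)).
  exists (f \o homeo_inv h) => //.
  exact: (@comp_continuous _ _ R[i]^o _ _ (@homeo_inv_continuous _ _ h) cf).
by rewrite E; congr of_CX; apply/funext => x /=; rewrite homeoK.
Qed.

End Isomorphism.

(** * From each condition to the others *)

(** The lifts of [h] and of its inverse; every identity holds on embedded points,
    where it reduces to one for [h]. *)
Lemma cover_conjugacy (A B : finType) (X : shift_space A) (Y : shift_space B)
    (h : homeo (points X) (points Y)) : is_conjugacy (@sigma A X) (@sigma B Y) h ->
  exists th : homeo (cover_space X) (cover_space Y),
    is_conjugacy (@sigma_cover A X) (@sigma_cover B Y) th /\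
    (forall t, h (pi_cover t) = pi_cover (th t)).
Proof.
move=> hs.
have [F [cF FE]] := lift_cover (conjugacy_sim_continuous hs).
have [G [cG GE]] := lift_cover (conjugacy_sim_continuous (conjugacy_sym hs)).
have idc (T : topologicalType) : continuous (@id T) by move=> t; exact: cvg_id.
have FK : cancel F G.
  apply: embed_dense; first exact: (closed_eq_pro_discrete (comp_continuous cF cG) (@idc _)).
  by move=> x; rewrite /= FE GE homeo_symE homeoK.
have GK : cancel G F.
  apply: embed_dense; first exact: (closed_eq_pro_discrete (comp_continuous cG cF) (@idc _)).
  by move=> x; rewrite /= GE FE homeo_symE homeo_invK.
exists (Homeo FK GK cF cG); split.
  apply: embed_dense => [|x].
    exact: (closed_eq_pro_discrete (comp_continuous (@sigma_cover_continuous A X) cF)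
      (comp_continuous cF (@sigma_cover_continuous B Y))).
  by rewrite /= sigma_embed !FE hs sigma_embed.
apply: embed_dense => [|x].
  exact: (closed_eq_pro_discrete (comp_continuous (@pi_cover_continuous A X)
    (@homeo_continuous _ _ h)) (comp_continuous cF (@pi_cover_continuous B Y))).
by rewrite /= FE !pi_embed.
Qed.

Lemma groupoid_iso_of_cover_conjugacy (A B : finType) (X : shift_space A) (Y : shift_space B)
    (h : homeo (points X) (points Y)) (th : homeo (cover_space X) (cover_space Y)) :
  is_conjugacy (@sigma_cover A X) (@sigma_cover B Y) th ->
  (forall t, h (pi_cover t) = pi_cover (th t)) ->
  exists Psi : homeo (groupoid X) (groupoid Y),
      [/\ is_groupoid_iso Psi,
          forall t, h (pi_cover t) = pi_cover (unit_map Psi t),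
          forall c, cocycle c = cocycle (Psi c) &
          forall c, Psi (eps c) = eps (Psi c)].
Proof.
move=> ths hpi.
exists (Homeo (arrow_mapK ths) (arrow_map_symK ths) (@arrow_map_continuous _ _ _ _ _ ths)
  (@arrow_map_continuous _ _ _ _ _ (conjugacy_sym ths))); split => /=.
- move=> c c' cc'.
  have h' : composable (arrow_map ths c) (arrow_map ths c').
    by rewrite /composable !arrow_mapE cc'.
  by exists h'; apply: groupoid_eq; reflexivity.
- by move=> t; rewrite /unit_map /= arrow_map_gunit hpi.
- by move=> c; reflexivity.
- exact: arrow_map_eps.
Qed.

(** [eps] maps the unit at [t] to the unit at the shift of [t], and every point of
    [X] is the image of a unit under [pi_cover]. *)
Lemma conjugacy_of_groupoid_iso (A B : finType) (X : shift_space A) (Y : shift_space B)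
    (h : homeo (points X) (points Y)) (Psi : homeo (groupoid X) (groupoid Y)) :
  (forall t, h (pi_cover t) = pi_cover (unit_map Psi t)) ->
  (forall c, Psi (eps c) = eps (Psi c)) -> is_conjugacy (@sigma A X) (@sigma B Y) h.
Proof.
move=> hpi Peps x.
have E : gunit (sigma_cover (embed x)) = eps (gunit (embed x)) by apply: groupoid_eq; reflexivity.
rewrite -(pi_embed x) -pi_sigma !hpi -pi_sigma /unit_map E Peps; reflexivity.
Qed.

Lemma points_separated (R : realType) (A : finType) (X : shift_space A) (x y : points X) :
  (forall f : points X -> R[i], continuous (f : points X -> R[i]^o) -> f x = f y) -> x = y.
Proof.
move=> fxy; apply: val_inj; apply/funext => n.
pose f (z : points X) : R[i] := (val z n == val y n)%:R.
have /fxy : continuous (f : points X -> R[i]^o).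
  move=> z U /nbhs_singleton Uz; apply: filterS (nbhs_coordinate z n) => z' e.
  suff : f z' = f z by move=> /= ->.
  by rewrite /f e.
rewrite /f eqxx; case: eqP => // _ /eqP; rewrite eq_sym oner_eq0//.
Qed.

(** Continuous functions separate points, so it is enough to test the
    commutation relation, written for the inverse of [h], on functions. *)
Lemma conjugacy_of_functions (R : realType) (A B : finType) (X : shift_space A)
    (Y : shift_space B) (h : homeo (points X) (points Y)) :
  (forall f : points X -> R[i], continuous (f : points X -> R[i]^o) ->
     forall y, f (sigma (homeo_inv h y)) = f (homeo_inv h (sigma y))) ->
  is_conjugacy (@sigma A X) (@sigma B Y) h.
Proof.
move=> hf; apply: (@conjugacy_sym _ _ _ _ (homeo_sym h)) => y.
by rewrite homeo_symE; apply: (@points_separated R) => f cf; rewrite hf.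
Qed.

Lemma of_CX_E (R : realType) (A : finType) (X : shift_space A) (f : points X -> R[i]) x :
  of_CX f (gunit (embed x)) = f x.
Proof. by rewrite /of_CX on_units_gunit /= pi_embed. Qed.

Lemma sigma_of_CX (R : realType) (A : finType) (X : shift_space A) (f : points X -> R[i]) :
  (f \o @pi_cover A X) \o @sigma_cover A X = (f \o @sigma A X) \o @pi_cover A X.
Proof. by apply/funext => t /=; rewrite pi_sigma. Qed.

Lemma OX_of_CX (R : realType) (A : finType) (X : shift_space A) (f : points X -> R[i]) :
  continuous (f : points X -> R[i]^o) -> OX (of_CX f).
Proof.
move=> cf; apply/Cc_OX/Cc_on_units.
exact: (@comp_continuous _ _ R[i]^o _ _ (@pi_cover_continuous A X) cf).
Qed.

Lemma sigma_continuous (A : finType) (X : shift_space A) : continuous (@sigma A X).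
Proof.
move=> x U /nbhs_initial_word[k kU]; apply/nbhs_initial_word; exists k.+1 => y /initial_wordP e.
by apply: kU; apply/initial_wordP => n nk; exact: e.
Qed.

(** [phi] restricts to composition with the shift on the functions on [X]; compare
    both sides of the hypothesis at [of_CX f]. *)
Lemma conjugacy_of_diagonal_iso (R : realType) (A B : finType) (X : shift_space A)
    (Y : shift_space B) (h : homeo (points X) (points Y))
    (Omega : (groupoid X -> R[i]) -> (groupoid Y -> R[i])) :
  extends_homeo h Omega -> (forall d, DX d -> Omega (phi d) = phi (Omega d)) ->
  is_conjugacy (@sigma A X) (@sigma B Y) h.
Proof.
move=> [_ OE] Ophi; apply: (@conjugacy_of_functions R) => f cf y.
have cfs : continuous (f \o @sigma A X : _ -> R[i]^o).
  exact: (@comp_continuous _ _ R[i]^o _ _ (@sigma_continuous A X) cf).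
have DXf : DX (of_CX f).
  exists (f \o @pi_cover A X) => //.
  exact: (@comp_continuous _ _ R[i]^o _ _ (@pi_cover_continuous A X) cf).
have := Ophi _ DXf; rewrite OE// /of_CX !phi_on_units !sigma_of_CX -!/(of_CX _) OE//.
by move=> /(congr1 (fun g => g (gunit (embed y)))); rewrite !of_CX_E.
Qed.

Lemma tau_of_CX (R : realType) (A : finType) (X : shift_space A) (f : points X -> R[i]) :
  tau (of_CX f) = convolution (of_CX (f \o @sigma A X)) (tau (of_CX (fun=> 1))).
Proof. by rewrite /of_CX tau_on_units sigma_of_CX. Qed.

(** Applying [Phi] to [tau f = (f \o sigma) * tau 1] and then [tau] to [Phi f]
    gives two elements with the common factor [tau 1], which is 1 at units. *)
Lemma conjugacy_of_tau_iso (R : realType) (A B : finType) (X : shift_space A)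
    (Y : shift_space B) (h : homeo (points X) (points Y))
    (Phi : (groupoid X -> R[i]) -> (groupoid Y -> R[i])) :
  is_star_iso (@OX R A X) (@OX R B Y) Phi -> extends_homeo h Phi ->
  (forall y, OX y -> Phi (tau y) = tau (Phi y)) ->
  is_conjugacy (@sigma A X) (@sigma B Y) h.
Proof.
move=> [_ _ _ PhiM _] [_ PhiE] Phitau; apply: (@conjugacy_of_functions R) => f cf y.
have cfs : continuous (f \o @sigma A X : _ -> R[i]^o).
  exact: (@comp_continuous _ _ R[i]^o _ _ (@sigma_continuous A X) cf).
have c1 : continuous ((fun=> 1) : points X -> R[i]^o).
  exact: (@cst_continuous _ R[i]^o 1).
have e1 := Phitau _ (OX_of_CX c1); have := Phitau _ (OX_of_CX cf).
rewrite tau_of_CX PhiM; [|exact: OX_of_CX|exact/Cc_OX/Cc_tau1].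
rewrite e1 !PhiE// [in RHS]tau_of_CX => /(congr1 (fun g => g (gunit (embed y)))).
rewrite /of_CX !convolution_on_units !tauE.
have -> : eps (gunit (embed y)) = gunit (sigma_cover (embed y)) by apply: groupoid_eq; reflexivity.
by rewrite !on_units_gunit /= !mulr1 !pi_embed.
Qed.

Theorem theorem4p4 (R : realType) (A B : finType)
    (X : shift_space A) (Y : shift_space B) (h : homeo (points X) (points Y)) :
  [<->
    (* i *)
    is_conjugacy (@sigma A X) (@sigma B Y) h;
    (* ii *)
    exists th : homeo (cover_space X) (cover_space Y),
      is_conjugacy (@sigma_cover A X) (@sigma_cover B Y) th /\
      (forall t, h (pi_cover t) = pi_cover (th t));
    (* iii *)
    exists Psi : homeo (groupoid X) (groupoid Y),
      [/\ is_groupoid_iso Psi,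
          forall t, h (pi_cover t) = pi_cover (unit_map Psi t),
          forall c, cocycle c = cocycle (Psi c) &
          forall c, Psi (eps c) = eps (Psi c)];
    (* iv *)
    exists Psi : homeo (groupoid X) (groupoid Y),
      [/\ is_groupoid_iso Psi,
          forall t, h (pi_cover t) = pi_cover (unit_map Psi t) &
          forall c, Psi (eps c) = eps (Psi c)];
    (* v *)
    exists Phi : (groupoid X -> R[i]) -> (groupoid Y -> R[i]),
      is_star_iso (@OX R A X) (@OX R B Y) Phi /\
      [/\ extends_homeo h Phi,
          forall y, OX y -> Phi (cond_exp y) = cond_exp (Phi y),
          forall z y, `|z| = 1 -> OX y -> Phi (gauge z y) = gauge z (Phi y),
          forall d, DX d -> Phi (phi d) = phi (Phi d) &
          forall y, OX y -> Phi (tau y) = tau (Phi y)];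
    (* vi *)
    exists Phi : (groupoid X -> R[i]) -> (groupoid Y -> R[i]),
      [/\ is_star_iso (@OX R A X) (@OX R B Y) Phi,
          extends_homeo h Phi &
          forall y, OX y -> Phi (tau y) = tau (Phi y)];
    (* vii *)
    exists Omega : (groupoid X -> R[i]) -> (groupoid Y -> R[i]),
      [/\ is_star_iso (@DX R A X) (@DX R B Y) Omega,
          extends_homeo h Omega &
          forall d, DX d -> Omega (phi d) = phi (Omega d)]
  ].
Proof.
tfae.
- exact: cover_conjugacy.
- by move=> [th [ths hpi]]; exact: groupoid_iso_of_cover_conjugacy ths hpi.
- by move=> [Psi [iso hpi _ Peps]]; exists Psi.
- move=> [Psi [_ hpi Peps]].
  have [th [ths thpi]] := cover_conjugacy (conjugacy_of_groupoid_iso hpi Peps).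
  have ths' := conjugacy_sym ths; have thpi' := intertwine_sym thpi.
  exists (pullback ths'); split.
    by apply: pullback_star_iso => f; exact: pullback_OX.
  split.
  + exact: pullback_extends thpi'.
  + by move=> y _; exact: cond_exp_pullback.
  + by move=> z y _ _; exact: gauge_pullback.
  + by move=> d; exact: phi_pullback.
  + by move=> y _; exact: tau_pullback.
- by move=> [Phi [iso [ext _ _ _ Phitau]]]; exists Phi.
- move=> [Phi [iso ext Phitau]].
  have [th [ths thpi]] := cover_conjugacy (conjugacy_of_tau_iso iso ext Phitau).
  have ths' := conjugacy_sym ths; have thpi' := intertwine_sym thpi.
  exists (pullback ths'); split.
  + by apply: pullback_star_iso => f; exact: pullback_DX.
  + exact: pullback_extends thpi'.
  + by move=> d; exact: phi_pullback.
- by move=> [Om [_ ext Ophi]]; exact: conjugacy_of_diagonal_iso ext Ophi.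
Qed.
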